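(* Let $0<q<1$. For every $n\in\mathbb{N}=\{1,2,\dots\}$, $$\eta_q(2n)=\frac{(-1)^{n+1}}{2\,[2n-1]!}+\sum_{k=0}^{n}\frac{(-1)^{k+1}}{[2k]!}\zeta_q(2n-2k),$$ where $\zeta_q(0)$ is understood as $-\tfrac12$, and $$\eta_q^*(2n+1)=\frac{(-1)^{n}}{2\,[2n]!}+\sum_{k=0}^{n-1}\frac{(-1)^{k}}{[2k+1]!}\zeta_q^{*}(2n-2k).$$
   Context: Fix $0<q<1$. $(x;q)_\infty=\prod_{j\ge 0}(1-xq^j)$, $[n]=\frac{1-q^n}{1-q}$, $[n]!=\prod_{k=1}^n[k]$, $[0]!=1$. $E_q(z)=(-(1-q)z;q)_\infty$. $\mathrm{Sin}_q z=\frac{E_q(iz)-E_q(-iz)}{2i}$ and $\mathrm{Cos}_q z=\frac{E_q(iz)+E_q(-iz)}{2}$. All zeros of these functions are real and simple; $(\xi_k)_{k\ge1}$ and $(\eta_k)_{k\ge1}$ denote the positive zeros of $\mathrm{Sin}_q$ and $\mathrm{Cos}_q$ respectively, in increasing order. Primes denote ordinary derivatives. For $\operatorname{Re}s>1$, $$\zeta_q(s)=\sum_{k=1}^{\infty}\frac{\mathrm{Cos}_q\xi_k}{\mathrm{Sin}_q'\xi_k}\frac1{\xi_k^s},\qquad \zeta_q^*(s)=-\sum_{k=1}^{\infty}\frac{\mathrm{Sin}_q\eta_k}{\mathrm{Cos}_q'\eta_k}\frac1{\eta_k^s},$$ and for $s\in\mathbb{C}$, $$\eta_q(s)=-\sum_{k=1}^\infty\frac{1}{\xi_k^s}\frac{1}{\mathrm{Sin}_q'\xi_k},\qquad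 \eta_q^*(s)=-\sum_{k=1}^\infty\frac{1}{\eta_k^s}\frac{1}{\mathrm{Cos}_q'\eta_k}.$$ *)

(* Defs.v *)
From Stdlib Require Import Reals.
From Coquelicot Require Import Coquelicot.
Open Scope R_scope.

(** Limit of a complex sequence and sum of a complex series, taken on real and
    imaginary parts; as with [Lim_seq] and [Series], the value is meaningful only
    in case of convergence. *)
Definition CLim_seq (u : nat -> C) : C :=
  (real (Lim_seq (fun n => Re (u n))), real (Lim_seq (fun n => Im (u n)))).

Definition CSeries (a : nat -> C) : C :=
  (Series (fun n => Re (a n)), Series (fun n => Im (a n))).

(** [x ^ s = exp (s * ln x)] for real [x > 0] and complex [s]. *)
Definition Rcpow (x : R) (s : C) : C :=
  (exp (Re s * ln x) * cos (Im s * ln x), exp (Re s * ln x) * sin (Im s * ln x)).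

Fixpoint qpoch (x : C) (q : R) (n : nat) : C :=
  match n with
  | O => 1%C
  | S m => (qpoch x q m * (1 - x * RtoC (q ^ m)))%C
  end.

Definition qpoch_inf (x : C) (q : R) : C := CLim_seq (qpoch x q).

Definition qnum (q : R) (n : nat) : R := (1 - q ^ n) / (1 - q).

Fixpoint qfact (q : R) (n : nat) : R :=
  match n with
  | O => 1
  | S m => qfact q m * qnum q (S m)
  end.

Definition E_q (q : R) (z : C) : C := qpoch_inf (- (RtoC (1 - q) * z))%C q.

Definition Sin_q (q : R) (z : C) : C :=
  ((E_q q (Ci * z) - E_q q (- (Ci * z))) / (2 * Ci))%C.

Definition Cos_q (q : R) (z : C) : C :=
  ((E_q q (Ci * z) + E_q q (- (Ci * z))) / 2)%C.

(** [x] lists all positive real zeros of [f] in increasing order. Indices start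
    at [0]: [x k] is the [(k+1)]-st positive zero. *)
Definition positive_zeros (f : C -> C) (x : nat -> R) : Prop :=
  (forall k, x k < x (S k)) /\
  (forall t : R, (0 < t /\ f (RtoC t) = RtoC 0) <-> exists k, x k = t).

(** In the four Dirichlet-type series below, [xi] and [eta] stand for the
    enumerations of the positive zeros of [Sin_q q] and [Cos_q q]. *)
Definition zeta_q (q : R) (xi : nat -> R) (s : C) : C :=
  CSeries (fun k => (Cos_q q (xi k) / C_derive (Sin_q q) (xi k)
                     * (1 / Rcpow (xi k) s))%C).

Definition zeta_q_star (q : R) (eta : nat -> R) (s : C) : C :=
  (- CSeries (fun k => Sin_q q (eta k) / C_derive (Cos_q q) (eta k)
                       * (1 / Rcpow (eta k) s)))%C.

Definition eta_q (q : R) (xi : nat -> R) (s : C) : C :=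
  (- CSeries (fun k => 1 / Rcpow (xi k) s
                       * (1 / C_derive (Sin_q q) (xi k))))%C.

Definition eta_q_star (q : R) (eta : nat -> R) (s : C) : C :=
  (- CSeries (fun k => 1 / Rcpow (eta k) s
                       * (1 / C_derive (Cos_q q) (eta k))))%C.

(** [zeta_q] with the conventional value [-1/2] at [s = 0], where the series
    diverges. *)
Definition zeta_q_conv (q : R) (xi : nat -> R) (s : C) : C :=
  if Ceq_dec s (RtoC 0) then RtoC (- (1 / 2)) else zeta_q q xi s.

(* Main.v *)
Require Import Defs.
From Stdlib Require Import Reals ZArith Lra Lia Psatz.
From Coquelicot Require Import Coquelicot.
Open Scope R_scope.

(** For real x write E_q(ix) = rho(x) e^(i theta(x)), where theta(x) is the sum of
    the arctan(c_j x) and c_j = (1-q) q^j; then Sin_q x = rho sin theta and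
    Cos_q x = rho cos theta, so the zeros are the solutions of theta = k pi and
    theta = (k + 1/2) pi, and all residues are expressed by theta'.

    Cutting the product E_q after finitely many factors turns Cos_q / Sin_q, 1 / Sin_q,
    Sin_q / Cos_q and 1 / Cos_q into rational functions of u = x^2 with real simple
    poles, whose partial fractions are Lagrange interpolation. The k-th pole r satisfies
    q^k r >= 1 and 1 / (r^2 theta'(r)) = O(q^k) uniformly in the number of factors, so
    Tannery's theorem carries the expansions over to the infinite product.

    Finally 1 / E_q(-z) is the sum of the z^n / [n]!. Its even and odd parts give
    cos_q Cos_q + sin_q Sin_q = 1, that is 1 / Sin_q = cos_q Cot_q + sin_q and
    1 / Cos_q = cos_q + sin_q Tan_q; the theorem compares coefficients at 0. *)

(** * Sums over the factors of E_q *)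

(* Equalities between Coquelicot sums live in [AbelianMonoid.sort _], where [ring] and
   [field] find no structure. *)
Ltac real_eq := match goal with |- @eq _ ?a ?b => change (@eq R a b) end.

(** The argument stays on the real line: [E_q] is evaluated only at imaginary points and every
    derivative is taken along the real axis. A truncated quotient can be expanded by interpolation
    only if all its poles are known and as many as its degree in u allows. The phase settles this:
    with n + 1 factors it increases from 0 towards (n + 1) pi / 2, and a suitable parity of n makes
    the number of values k pi, or (k + 1/2) pi, that it takes equal to the degree bound.

    Since the c_j add up to 1, sums over j of functions with Lipschitz constant c_j are 1-Lipschitz
    uniformly in the number of factors. Hence limits can be taken at arguments that move with the
    truncation, as its poles do.

    Coefficients are compared on (0, 1/2), where theta stays below pi / 2 and all poles, being at
    least 1, keep their distance. There x Cot_q x has constant term 1, and zeta_q(2m) is -1/2 times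
    its coefficient of x^(2m); this is the source of the convention zeta_q(0) = -1/2. *)

Definition cq (q : R) (j : nat) : R := (1 - q) * q ^ j.

Lemma cq_pos q j : 0 < q < 1 -> 0 < cq q j.
Proof. intros hq; unfold cq; apply Rmult_lt_0_compat; [lra | apply pow_lt; lra]. Qed.

Lemma pow_le_1 q j : 0 < q < 1 -> q ^ j <= 1.
Proof.
  intros hq; induction j as [|j IH]; simpl; [lra|].
  assert (0 < q ^ j) by (apply pow_lt; lra). nra.
Qed.

Lemma cq_lt_1 q j : 0 < q < 1 -> cq q j < 1.
Proof.
  intros hq; unfold cq.
  assert (H := pow_le_1 q j hq). assert (0 < q ^ j) by (apply pow_lt; lra). nra.
Qed.

Lemma cq_decreasing q i j : 0 < q < 1 -> (i <= j)%nat -> cq q j <= cq q i.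
Proof.
  intros hq hij; unfold cq. replace j with (i + (j - i))%nat by lia.
  rewrite pow_add. assert (H := pow_le_1 q (j - i) hq).
  assert (0 < q ^ i) by (apply pow_lt; lra).
  apply Rmult_le_compat_l; [lra|]. nra.
Qed.

Lemma sum_cq q n : 0 < q < 1 -> sum_n (cq q) n = 1 - q ^ S n.
Proof.
  intros hq; induction n as [|n IH].
  - rewrite sum_O; unfold cq; simpl; ring.
  - rewrite sum_Sn, IH; unfold cq, plus; simpl; ring.
Qed.

Lemma sum_cq_le_1 q n : 0 < q < 1 -> sum_n (cq q) n <= 1.
Proof. intros hq; rewrite sum_cq by easy. assert (0 < q ^ S n) by (apply pow_lt; lra). lra. Qed.

Lemma is_series_cq q : 0 < q < 1 -> is_series (cq q) 1.
Proof.
  intros hq. replace 1 with ((1 - q) * / (1 - q)) by (field; lra).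
  apply (is_series_scal (V := R_NormedModule) (1 - q) (fun j => q ^ j)).
  apply is_series_geom. rewrite Rabs_pos_eq; lra.
Qed.

Lemma sum_n_Rabs_le (a b : nat -> R) n :
  (forall k, (k <= n)%nat -> Rabs (a k) <= b k) -> Rabs (sum_n a n) <= sum_n b n.
Proof.
  intros H; induction n as [|n IH].
  - rewrite !sum_O; apply H; lia.
  - rewrite !sum_Sn. unfold plus; simpl.
    eapply Rle_trans; [apply Rabs_triang|].
    apply Rplus_le_compat; [apply IH; intros; apply H; lia | apply H; lia].
Qed.

Lemma sum_n_Rmult_r (a : nat -> R) (x : R) n :
  sum_n (fun k => a k * x) n = sum_n a n * x.
Proof. exact (sum_n_mult_r x a n). Qed.

Lemma sum_n_Rminus (a b : nat -> R) n :
  sum_n (fun k => a k - b k) n = sum_n a n - sum_n b n.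
Proof.
  induction n as [|n IH]; [now rewrite !sum_O|].
  rewrite !sum_Sn, IH; unfold plus; simpl; ring.
Qed.

(** One interface for the summands of theta, log rho and their derivatives: the constant c, summed
    over the c_j, gives at most 1, so sums converge and are 1-Lipschitz uniformly in their
    length. *)
Definition lipschitz_family (g : R -> R -> R) : Prop :=
  (forall c, 0 < c < 1 -> Rabs (g c 0) <= c) /\
  (forall c x y, 0 < c < 1 -> Rabs (g c y - g c x) <= c * Rabs (y - x)).

Definition gsum (g : R -> R -> R) (q : R) (n : nat) (x : R) : R :=
  sum_n (fun j => g (cq q j) x) n.

Definition gser (g : R -> R -> R) (q : R) (x : R) : R :=
  Series (fun j => g (cq q j) x).

Lemma lipschitz_family_bound g c x :
  lipschitz_family g -> 0 < c < 1 -> Rabs (g c x) <= c * (1 + Rabs x).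
Proof.
  intros [h0 hl] hc. replace (g c x) with (g c 0 + (g c x - g c 0)) by ring.
  eapply Rle_trans; [apply Rabs_triang|].
  specialize (h0 c hc). specialize (hl c 0 x hc). rewrite Rminus_0_r in hl. lra.
Qed.

Lemma gser_ex g q x : lipschitz_family g -> 0 < q < 1 ->
  ex_series (fun j => g (cq q j) x).
Proof.
  intros hg hq.
  apply (ex_series_le (K := R_AbsRing) (V := R_CompleteNormedModule) _
           (fun j => (1 + Rabs x) * cq q j)).
  - intros j. change (norm ?a) with (Rabs a). rewrite Rmult_comm.
    apply lipschitz_family_bound; [easy|]. split; [apply cq_pos | apply cq_lt_1]; easy.
  - apply (ex_series_scal (V := R_NormedModule)). eexists; now apply is_series_cq.
Qed.

Lemma gsum_lim g q x : lipschitz_family g -> 0 < q < 1 ->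
  is_lim_seq (fun n => gsum g q n x) (gser g q x).
Proof.
  intros hg hq.
  exact (Series_correct _ (gser_ex g q x hg hq)).
Qed.

Lemma gsum_lipschitz g q n x y : lipschitz_family g -> 0 < q < 1 ->
  Rabs (gsum g q n y - gsum g q n x) <= Rabs (y - x).
Proof.
  intros [h0 hl] hq. unfold gsum. rewrite <- sum_n_Rminus.
  eapply Rle_trans.
  - apply sum_n_Rabs_le with (b := fun j => cq q j * Rabs (y - x)).
    intros k _; apply hl; split; [apply cq_pos | apply cq_lt_1]; easy.
  - rewrite sum_n_Rmult_r.
    assert (H := sum_cq_le_1 q n hq). assert (H' := Rabs_pos (y - x)). nra.
Qed.

(** The uniform Lipschitz bound lets truncation and argument vary together. This is applied at the
    roots of the truncated phases, which move with the truncation. *)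
Lemma gsum_lim_moving g q (xs : nat -> R) (nn : nat -> nat) (x : R) :
  lipschitz_family g -> 0 < q < 1 ->
  filterlim nn eventually eventually -> is_lim_seq xs x ->
  is_lim_seq (fun m => gsum g q (nn m) (xs m)) (gser g q x).
Proof.
  intros hg hq hn hx.
  apply is_lim_seq_ext with
    (u := fun m => gsum g q (nn m) x + (gsum g q (nn m) (xs m) - gsum g q (nn m) x)).
  { intros m; ring. }
  replace (gser g q x) with (gser g q x + 0) by ring.
  apply is_lim_seq_plus'.
  - apply (is_lim_seq_subseq (fun n => gsum g q n x)); [easy | now apply gsum_lim].
  - apply (proj2 (is_lim_seq_abs_0 _)).
    apply is_lim_seq_le_le with (u := fun _ => 0) (w := fun m => Rabs (xs m - x)).
    + intros m; split; [apply Rabs_pos | now apply gsum_lipschitz].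
    + apply is_lim_seq_const.
    + apply -> is_lim_seq_abs_0.
      replace 0 with (x - x) by ring. apply is_lim_seq_minus'; [easy | apply is_lim_seq_const].
Qed.

Lemma taylor_lipschitz (g dg : R -> R) (c x y : R) :
  (forall t, is_derive g t (dg t)) ->
  (forall s t, Rabs (dg t - dg s) <= c * Rabs (t - s)) -> 0 <= c ->
  Rabs (g y - g x - (y - x) * dg x) <= c * (y - x) ^ 2.
Proof.
  intros hd hl hc.
  destruct (MVT_gen g x y dg) as (t & ht & e).
  - intros; apply hd.
  - intros t _. apply derivable_continuous_pt. exists (dg t). apply is_derive_Reals, hd.
  - rewrite e. replace (dg t * (y - x) - (y - x) * dg x) with ((dg t - dg x) * (y - x)) by ring.
    rewrite Rabs_mult. rewrite <- (pow2_abs (y - x)).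
    assert (Rabs (t - x) <= Rabs (y - x)).
    { revert ht; unfold Rmin, Rmax; destruct (Rle_dec x y); intros;
        unfold Rabs; destruct (Rcase_abs (t - x)), (Rcase_abs (y - x)); lra. }
    specialize (hl x t). assert (h := Rabs_pos (y - x)). assert (h' := Rabs_pos (t - x)).
    assert (Rabs (dg t - dg x) <= c * Rabs (y - x)).
    { eapply Rle_trans; [apply hl|]. now apply Rmult_le_compat_l. }
    simpl. rewrite Rmult_1_r, <- Rmult_assoc. apply Rmult_le_compat_r; easy.
Qed.

Lemma lipschitz_family_derive g dg :
  (forall c t, 0 < c < 1 -> is_derive (g c) t (dg c t)) ->
  (forall c t, 0 < c < 1 -> Rabs (dg c t) <= c) ->
  (forall c, 0 < c < 1 -> g c 0 = 0) -> lipschitz_family g.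
Proof.
  intros hd hb h0; split.
  - intros c hc; rewrite h0, Rabs_R0; lra.
  - intros c x y hc. destruct (MVT_gen (g c) x y (dg c)) as (t & ht & e).
    + intros; now apply hd.
    + intros t _. apply derivable_continuous_pt. exists (dg c t). now apply is_derive_Reals, hd.
    + rewrite e, Rabs_mult. apply Rmult_le_compat_r; [apply Rabs_pos | now apply hb].
Qed.

(** A remainder bound of this shape passes to pointwise limits, so termwise differentiation needs no
    uniform convergence of the derivatives. *)
Lemma is_derive_quadratic (f : R -> R) (x l K : R) :
  (forall y, Rabs (f y - f x - (y - x) * l) <= K * (y - x) ^ 2) -> is_derive f x l.
Proof.
  intros H. apply is_derive_Reals. intros eps heps.
  assert (hd : 0 < eps / (Rabs K + 1)).
  { apply Rdiv_lt_0_compat; [easy|]. assert (h := Rabs_pos K); lra. }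
  exists (mkposreal _ hd). simpl. intros h hh hlt.
  specialize (H (x + h)). replace (x + h - x) with h in H by ring.
  replace ((f (x + h) - f x) / h - l) with ((f (x + h) - f x - h * l) / h) by (field; easy).
  unfold Rdiv; rewrite Rabs_mult, Rabs_inv.
  assert (hp : 0 < Rabs h) by now apply Rabs_pos_lt.
  apply Rmult_lt_reg_r with (Rabs h); [easy|].
  rewrite Rmult_assoc, Rinv_l, Rmult_1_r by lra.
  eapply Rle_lt_trans; [apply H|]. rewrite <- (pow2_abs h).
  assert (hK := Rle_abs K). assert (hK' := Rabs_pos K).
  apply Rmult_lt_compat_r with (r := Rabs K + 1) in hlt; [|lra].
  unfold Rdiv in hlt; rewrite Rmult_assoc, Rinv_l, Rmult_1_r in hlt by lra. nra.
Qed.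

(** The j-th term has Taylor remainder at most c_j (y - x)^2 by [taylor_lipschitz]. Summation gives
    the constant 1 for every partial sum, hence for the limit. *)
Lemma gser_derive g dg q x :
  (forall c t, 0 < c < 1 -> is_derive (g c) t (dg c t)) ->
  lipschitz_family g -> lipschitz_family dg -> 0 < q < 1 ->
  is_derive (gser g q) x (gser dg q x).
Proof.
  intros hd hg hdg hq. apply is_derive_quadratic with (K := 1). intros y.
  assert (hle : forall n, Rabs (gsum g q n y - gsum g q n x - (y - x) * gsum dg q n x)
                     <= 1 * (y - x) ^ 2).
  { intros n. unfold gsum. rewrite Rmult_comm, <- sum_n_Rmult_r, <- !sum_n_Rminus.
    eapply Rle_trans.
    - apply sum_n_Rabs_le with (b := fun j => cq q j * (y - x) ^ 2).
      intros k _. assert (hc : 0 < cq q k < 1) by (split; [apply cq_pos | apply cq_lt_1]; easy).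
      rewrite (Rmult_comm (dg _ x)). apply taylor_lipschitz; [now intros; apply hd| |lra].
      intros s t; now apply hdg.
    - rewrite sum_n_Rmult_r. apply Rmult_le_compat_r; [apply pow2_ge_0 | now apply sum_cq_le_1]. }
  assert (hlim : is_lim_seq (fun n => Rabs (gsum g q n y - gsum g q n x - (y - x) * gsum dg q n x))
                   (Rabs (gser g q y - gser g q x - (y - x) * gser dg q x))).
  { apply (is_lim_seq_abs _ (Finite _)). apply is_lim_seq_minus'; [apply is_lim_seq_minus'|];
      try now apply gsum_lim.
    apply (is_lim_seq_scal_l _ _ (Finite _)). now apply gsum_lim. }
  exact (is_lim_seq_le _ _ _ _ hle hlim (is_lim_seq_const _)).
Qed.

Lemma gsum_derive g dg q n x :
  (forall c t, 0 < c < 1 -> is_derive (g c) t (dg c t)) -> 0 < q < 1 ->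
  is_derive (gsum g q n) x (gsum dg q n x).
Proof.
  intros hd hq. unfold gsum.
  apply (is_derive_sum_n (fun j y => g (cq q j) y)). intros k _. apply hd.
  split; [apply cq_pos | apply cq_lt_1]; easy.
Qed.

(* The summands of theta, theta', log rho and (log rho)'. *)
Definition atf (c x : R) : R := atan (c * x).
Definition datf (c x : R) : R := c / (1 + (c * x) ^ 2).
Definition lnf (c x : R) : R := ln (1 + (c * x) ^ 2) / 2.
Definition dlnf (c x : R) : R := c * (c * x) / (1 + (c * x) ^ 2).

Lemma is_derive_atf c x : is_derive (atf c) x (datf c x).
Proof.
  unfold atf, datf. auto_derive; [easy|]. unfold Rsqr. field.
  assert (h := pow2_ge_0 (c * x)). simpl in *; nra.
Qed.

Lemma is_derive_lnf c x : is_derive (lnf c) x (dlnf c x).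
Proof.
  unfold lnf, dlnf. assert (h := pow2_ge_0 (c * x)). auto_derive.
  - simpl in *; nra.
  - field. simpl in *; nra.
Qed.

Lemma datf_bound c x : 0 < c < 1 -> Rabs (datf c x) <= c.
Proof.
  intros hc. unfold datf. assert (h := pow2_ge_0 (c * x)).
  rewrite Rabs_pos_eq; [|apply Rdiv_le_0_compat; lra].
  apply Rle_div_l; nra.
Qed.

Lemma dlnf_bound c x : 0 < c < 1 -> Rabs (dlnf c x) <= c.
Proof.
  intros hc. unfold dlnf. assert (h := pow2_ge_0 (c * x)).
  unfold Rdiv. rewrite Rabs_mult, Rabs_inv, (Rabs_pos_eq (1 + _)) by lra.
  apply Rle_div_l; [lra|]. rewrite Rabs_mult, (Rabs_pos_eq c) by lra.
  apply Rmult_le_compat_l; [lra|].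
  rewrite <- pow2_abs. assert (h' := Rabs_pos (c * x)).
  assert (h2 := pow2_ge_0 (Rabs (c * x) - 1)). nra.
Qed.

Lemma atf_lipschitz : lipschitz_family atf.
Proof.
  apply lipschitz_family_derive with datf.
  - intros; apply is_derive_atf.
  - apply datf_bound.
  - intros; unfold atf; rewrite Rmult_0_r; apply atan_0.
Qed.

Lemma lnf_lipschitz : lipschitz_family lnf.
Proof.
  apply lipschitz_family_derive with dlnf.
  - intros; apply is_derive_lnf.
  - apply dlnf_bound.
  - intros c _; unfold lnf. replace (1 + (c * 0) ^ 2) with 1 by ring. rewrite ln_1; lra.
Qed.

(** Both differences contain the factor b - a; the cofactors are bounded by 1 because |a + b| and |1
    - ab| are at most (1 + a^2)(1 + b^2). *)
Lemma quotient_lipschitz (a b : R) :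
  Rabs (/ (1 + b ^ 2) - / (1 + a ^ 2)) <= Rabs (b - a) /\
  Rabs (b / (1 + b ^ 2) - a / (1 + a ^ 2)) <= Rabs (b - a).
Proof.
  assert (ha := pow2_ge_0 a). assert (hb := pow2_ge_0 b).
  assert (hD : 0 < (1 + b ^ 2) * (1 + a ^ 2)) by nra.
  assert (hab := pow2_ge_0 (a * b)).
  assert (h1 := pow2_ge_0 (a * b - 1)). assert (h2 := pow2_ge_0 (a * b + 1)).
  assert (h3 := pow2_ge_0 (a - 1)). assert (h4 := pow2_ge_0 (a + 1)).
  assert (h5 := pow2_ge_0 (b - 1)). assert (h6 := pow2_ge_0 (b + 1)).
  split.
  - replace (/ (1 + b ^ 2) - / (1 + a ^ 2))
      with ((b - a) * (- (a + b) / ((1 + b ^ 2) * (1 + a ^ 2)))) by (field; lra).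
    rewrite Rabs_mult. rewrite <- (Rmult_1_r (Rabs (b - a))) at 2.
    apply Rmult_le_compat_l; [apply Rabs_pos|].
    apply Rabs_le; split; [apply Rle_div_r; [easy|] | apply Rle_div_l; [easy|]]; nra.
  - replace (b / (1 + b ^ 2) - a / (1 + a ^ 2))
      with ((b - a) * ((1 - a * b) / ((1 + b ^ 2) * (1 + a ^ 2)))) by (field; lra).
    rewrite Rabs_mult. rewrite <- (Rmult_1_r (Rabs (b - a))) at 2.
    apply Rmult_le_compat_l; [apply Rabs_pos|].
    apply Rabs_le; split; [apply Rle_div_r; [easy|] | apply Rle_div_l; [easy|]]; nra.
Qed.

Lemma datf_lipschitz : lipschitz_family datf.
Proof.
  split.
  - intros; now apply datf_bound.
  - intros c x y hc. destruct (quotient_lipschitz (c * x) (c * y)) as [h _].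
    unfold datf, Rdiv. rewrite <- Rmult_minus_distr_l, Rabs_mult, (Rabs_pos_eq c) by lra.
    apply Rmult_le_compat_l; [lra|]. eapply Rle_trans; [apply h|].
    rewrite <- Rmult_minus_distr_l, Rabs_mult, (Rabs_pos_eq c) by lra.
    assert (h' := Rabs_pos (y - x)). nra.
Qed.

Lemma dlnf_lipschitz : lipschitz_family dlnf.
Proof.
  split.
  - intros; now apply dlnf_bound.
  - intros c x y hc. destruct (quotient_lipschitz (c * x) (c * y)) as [_ h].
    replace (dlnf c y - dlnf c x)
      with (c * (c * y / (1 + (c * y) ^ 2) - c * x / (1 + (c * x) ^ 2)))
      by (unfold dlnf, Rdiv; ring).
    rewrite Rabs_mult, (Rabs_pos_eq c) by lra.
    apply Rmult_le_compat_l; [lra|]. eapply Rle_trans; [apply h|].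
    rewrite <- Rmult_minus_distr_l, Rabs_mult, (Rabs_pos_eq c) by lra.
    assert (h' := Rabs_pos (y - x)). nra.
Qed.

(** * Modulus and phase of E_q on the imaginary axis *)

(* The product of the factors j <= n of E_q(ix) is c_n(x^2) + i x s_n(x^2), with
   [cspol q n u = (c_n(u), s_n(u))]. *)
Fixpoint cspol (q : R) (n : nat) (u : R) : R * R :=
  match n with
  | O => (1, cq q 0)
  | S m => (fst (cspol q m u) - cq q n * u * snd (cspol q m u),
            snd (cspol q m u) + cq q n * fst (cspol q m u))
  end.

Definition theta_n q n x := gsum atf q n x.
Definition rho_n q n x := exp (gsum lnf q n x).
Definition theta q x := gser atf q x.
Definition rho q x := exp (gser lnf q x).

(** Polar form of 1 + iv. *)
Lemma polar_factor (v : R) :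
  exp (ln (1 + v ^ 2) / 2) * cos (atan v) = 1 /\
  exp (ln (1 + v ^ 2) / 2) * sin (atan v) = v.
Proof.
  assert (hv := pow2_ge_0 v).
  assert (e : exp (ln (1 + v ^ 2) / 2) = sqrt (1 + v ^ 2)).
  { rewrite <- Rpower_sqrt by lra. unfold Rpower. f_equal. field. }
  assert (hs : 0 < sqrt (1 + v ^ 2)) by (apply sqrt_lt_R0; lra).
  rewrite e, cos_atan, sin_atan. unfold Rsqr. replace (v * v) with (v ^ 2) by ring.
  split; field; lra.
Qed.

(** Multiplying the polar forms of the factors 1 + i c_j x adds the [lnf] and the [atf] terms. *)
Lemma polar_cspol q n x :
  rho_n q n x * cos (theta_n q n x) = fst (cspol q n (x ^ 2)) /\
  rho_n q n x * sin (theta_n q n x) = x * snd (cspol q n (x ^ 2)).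
Proof.
  unfold rho_n, theta_n, gsum. induction n as [|n [IHc IHs]].
  - rewrite !sum_O. unfold lnf, atf. simpl cspol. unfold fst, snd.
    destruct (polar_factor (cq q 0 * x)) as [h1 h2].
    rewrite h1, h2. split; ring.
  - rewrite !sum_Sn. change plus with Rplus.
    destruct (polar_factor (cq q (S n) * x)) as [h1 h2].
    change (ln (1 + (cq q (S n) * x) ^ 2) / 2) with (lnf (cq q (S n)) x) in h1, h2.
    change (atan (cq q (S n) * x)) with (atf (cq q (S n)) x) in h1, h2.
    cbn [cspol fst snd].
    set (L := sum_n (fun j => lnf (cq q j) x) n) in *.
    set (T := sum_n (fun j => atf (cq q j) x) n) in *.
    set (a := lnf (cq q (S n)) x) in *. set (b := atf (cq q (S n)) x) in *.
    rewrite exp_plus, cos_plus, sin_plus.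
    split.
    + transitivity ((exp L * cos T) * (exp a * cos b) - (exp L * sin T) * (exp a * sin b));
        [ring|]. rewrite h1, h2, IHc, IHs; ring.
    + transitivity ((exp L * sin T) * (exp a * cos b) + (exp L * cos T) * (exp a * sin b));
        [ring|]. rewrite h1, h2, IHc, IHs; ring.
Qed.

Lemma qpoch_imaginary q n y :
  qpoch (- (RtoC (1 - q) * (0, y)))%C q (S n) =
  (fst (cspol q n (y ^ 2)), y * snd (cspol q n (y ^ 2))).
Proof.
  induction n as [|n IH].
  - apply injective_projections; simpl; unfold cq; simpl; ring.
  - change (qpoch (- (RtoC (1 - q) * (0, y))) q (S (S n)))
      with (qpoch (- (RtoC (1 - q) * (0, y))) q (S n)
            * (1 - - (RtoC (1 - q) * (0, y)) * RtoC (q ^ S n)))%C.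
    rewrite IH. simpl cspol.
    apply injective_projections; simpl; unfold cq; simpl; ring.
Qed.

(** Together with [rho_even] this makes E_q(-ix) the conjugate of E_q(ix), so that [Sin_q] and
    [Cos_q] at x are its imaginary and real parts. *)
Lemma theta_odd q x : theta q (- x) = - theta q x.
Proof.
  unfold theta, gser. rewrite <- Series_opp. apply Series_ext. intros j.
  unfold atf. rewrite <- Ropp_mult_distr_r. apply atan_opp.
Qed.

Lemma rho_even q x : rho q (- x) = rho q x.
Proof.
  unfold rho, gser. f_equal. apply Series_ext. intros j.
  unfold lnf. do 3 f_equal. ring.
Qed.

Lemma rho_n_lim_moving q (xs : nat -> R) (nn : nat -> nat) (x : R) : 0 < q < 1 ->
  filterlim nn eventually eventually -> is_lim_seq xs x ->
  is_lim_seq (fun m => rho_n q (nn m) (xs m)) (rho q x).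
Proof.
  intros hq hn hx. unfold rho_n, rho.
  apply (is_lim_seq_continuous exp).
  - apply derivable_continuous_pt, derivable_pt_exp.
  - now apply gsum_lim_moving; [apply lnf_lipschitz| | |].
Qed.

Lemma theta_n_lim_moving q (xs : nat -> R) (nn : nat -> nat) (x : R) : 0 < q < 1 ->
  filterlim nn eventually eventually -> is_lim_seq xs x ->
  is_lim_seq (fun m => theta_n q (nn m) (xs m)) (theta q x).
Proof.
  intros hq hn hx. now apply gsum_lim_moving; [apply atf_lipschitz| | |].
Qed.

Lemma is_lim_seq_cos (u : nat -> R) (l : R) :
  is_lim_seq u l -> is_lim_seq (fun n => cos (u n)) (cos l).
Proof. apply is_lim_seq_continuous, continuity_cos. Qed.

Lemma is_lim_seq_sin (u : nat -> R) (l : R) :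
  is_lim_seq u l -> is_lim_seq (fun n => sin (u n)) (sin l).
Proof. apply is_lim_seq_continuous, continuity_sin. Qed.

Lemma E_q_imaginary q y : 0 < q < 1 ->
  E_q q (0, y) = (rho q y * cos (theta q y), rho q y * sin (theta q y)).
Proof.
  intros hq. unfold E_q, qpoch_inf, CLim_seq.
  assert (hr := rho_n_lim_moving q (fun _ => y) (fun n => n) y hq (filterlim_id _ _)
                  (is_lim_seq_const _)).
  assert (ht := theta_n_lim_moving q (fun _ => y) (fun n => n) y hq (filterlim_id _ _)
                  (is_lim_seq_const _)).
  apply injective_projections; cbn [fst snd].
  (* In [qpoch] the index counts factors, in [cspol] it is the last exponent; hence the shift by one
     before the two are compared. *)
  - rewrite (is_lim_seq_unique _ (rho q y * cos (theta q y))); [easy|].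
    apply is_lim_seq_incr_1.
    apply is_lim_seq_ext with (u := fun n => rho_n q n y * cos (theta_n q n y)).
    + intros n. rewrite qpoch_imaginary. apply polar_cspol.
    + apply is_lim_seq_mult'; [easy | now apply is_lim_seq_cos].
  - rewrite (is_lim_seq_unique _ (rho q y * sin (theta q y))); [easy|].
    apply is_lim_seq_incr_1.
    apply is_lim_seq_ext with (u := fun n => rho_n q n y * sin (theta_n q n y)).
    + intros n. rewrite qpoch_imaginary. apply polar_cspol.
    + apply is_lim_seq_mult'; [easy | now apply is_lim_seq_sin].
Qed.

Lemma Sin_q_real q x : 0 < q < 1 -> Sin_q q (RtoC x) = RtoC (rho q x * sin (theta q x)).
Proof.
  intros hq. unfold Sin_q.
  replace (Ci * RtoC x)%C with ((0, x) : C)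
    by (apply injective_projections; simpl; ring).
  replace (- (0, x))%C with ((0, - x) : C)
    by (apply injective_projections; simpl; ring).
  rewrite !E_q_imaginary, theta_odd, rho_even, cos_neg, sin_neg by easy.
  apply injective_projections; simpl; field.
Qed.

Lemma Cos_q_real q x : 0 < q < 1 -> Cos_q q (RtoC x) = RtoC (rho q x * cos (theta q x)).
Proof.
  intros hq. unfold Cos_q.
  replace (Ci * RtoC x)%C with ((0, x) : C)
    by (apply injective_projections; simpl; ring).
  replace (- (0, x))%C with ((0, - x) : C)
    by (apply injective_projections; simpl; ring).
  rewrite !E_q_imaginary, theta_odd, rho_even, cos_neg, sin_neg by easy.
  apply injective_projections; simpl; field.
Qed.

Lemma is_derive_theta q x : 0 < q < 1 -> is_derive (theta q) x (gser datf q x).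
Proof.
  intros hq. apply gser_derive; [intros; apply is_derive_atf| | |easy].
  apply atf_lipschitz. apply datf_lipschitz.
Qed.

Lemma is_derive_theta_n q n x : 0 < q < 1 -> is_derive (theta_n q n) x (gsum datf q n x).
Proof. intros hq. apply gsum_derive; [intros; apply is_derive_atf|easy]. Qed.

Lemma is_derive_rho_n q n x : 0 < q < 1 ->
  is_derive (rho_n q n) x (gsum dlnf q n x * rho_n q n x).
Proof.
  intros hq. unfold rho_n.
  apply (is_derive_comp exp); [apply is_derive_exp | ].
  apply gsum_derive; [intros; apply is_derive_lnf|easy].
Qed.

Lemma is_derive_rho q x : 0 < q < 1 -> is_derive (rho q) x (gser dlnf q x * rho q x).
Proof.
  intros hq. unfold rho.
  apply (is_derive_comp exp); [apply is_derive_exp | ].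
  apply gser_derive; [intros; apply is_derive_lnf| | |easy].
  apply lnf_lipschitz. apply dlnf_lipschitz.
Qed.

(** [C_derive] is a limit of difference quotients along the horizontal line through the point. At a
    real point only the values of F on the real axis enter. *)
Lemma C_derive_real (F : C -> C) (f : R -> R) (x l : R) :
  (forall t, F (RtoC t) = RtoC (f t)) -> is_derive f x l -> C_derive F (RtoC x) = RtoC l.
Proof.
  intros hF hd. unfold C_derive, C_lim.
  apply injective_projections; cbn [fst snd].
  - rewrite (is_lim_unique _ _ l); [easy|].
    apply is_derive_Reals in hd.
    apply is_lim_spec. intros eps. destruct (hd eps (cond_pos eps)) as [d Hd].
    exists d. intros y hy hne. change R in y. change (y <> x) in hne. change (Rabs (y - x) < d) in hy.
    change (y, snd (RtoC x)) with (RtoC y).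
    rewrite !hF. assert (hyx : y - x <> 0) by lra.
    specialize (Hd (y - x) hyx). replace (x + (y - x)) with y in Hd by ring.
    rewrite <- !RtoC_minus, <- RtoC_div by easy. now apply Hd.
  - rewrite (is_lim_unique _ _ 0); [easy|].
    apply is_lim_spec. intros eps. exists eps. intros y hy hne. change R in y.
    change (y, snd (RtoC x)) with (RtoC y). change (y <> x) in hne.
    rewrite !hF. rewrite <- !RtoC_minus, <- RtoC_div by lra.
    simpl. rewrite Rminus_0_r, Rabs_R0. apply cond_pos.
Qed.

(** The term with rho' carries the factor sin theta and drops out, so residues involve only rho and
    theta'. *)
Lemma C_derive_Sin_q q x : 0 < q < 1 -> sin (theta q x) = 0 ->
  C_derive (Sin_q q) (RtoC x) = RtoC (rho q x * gser datf q x * cos (theta q x)).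
Proof.
  intros hq h0. apply C_derive_real with (f := fun t => rho q t * sin (theta q t)).
  - intros t; now apply Sin_q_real.
  - evar_last.
    + apply (is_derive_mult (rho q) (fun t => sin (theta q t)) x).
      * now apply is_derive_rho.
      * apply (is_derive_comp sin); [apply is_derive_sin | now apply is_derive_theta].
      * intros; apply Rmult_comm.
    + unfold plus, mult, scal; simpl; unfold mult; simpl. rewrite h0. ring.
Qed.

Lemma C_derive_Cos_q q x : 0 < q < 1 -> cos (theta q x) = 0 ->
  C_derive (Cos_q q) (RtoC x) = RtoC (- (rho q x * gser datf q x * sin (theta q x))).
Proof.
  intros hq h0. apply C_derive_real with (f := fun t => rho q t * cos (theta q t)).
  - intros t; now apply Cos_q_real.
  - evar_last.
    + apply (is_derive_mult (rho q) (fun t => cos (theta q t)) x).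
      * now apply is_derive_rho.
      * apply (is_derive_comp cos); [apply is_derive_cos | now apply is_derive_theta].
      * intros; apply Rmult_comm.
    + unfold plus, mult, scal; simpl; unfold mult; simpl. rewrite h0. ring.
Qed.

(** * Monotonicity of the phase and location of the zeros *)

Lemma sum_n_le (a b : nat -> R) n :
  (forall k, (k <= n)%nat -> a k <= b k) -> sum_n a n <= sum_n b n.
Proof.
  intros H; induction n as [|n IH].
  - rewrite !sum_O; apply H; lia.
  - rewrite !sum_Sn. change plus with Rplus.
    apply Rplus_le_compat; [apply IH; intros; apply H; lia | apply H; lia].
Qed.

Lemma sum_n_ge_term (a : nat -> R) j n :
  (forall k, 0 <= a k) -> (j <= n)%nat -> a j <= sum_n a n.
Proof.
  intros ha hj. assert (hs : forall n, 0 <= sum_n a n).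
  { intros m; induction m as [|m IH]; [now rewrite sum_O|].
    rewrite sum_Sn. change plus with Rplus. specialize (ha (S m)); lra. }
  induction n as [|n IH].
  - replace j with O by lia. rewrite sum_O; lra.
  - rewrite sum_Sn. change plus with Rplus.
    destruct (Nat.eq_dec j (S n)) as [->|hne].
    + specialize (hs n); lra.
    + assert (h := IH ltac:(lia)). specialize (ha (S n)); lra.
Qed.

(** Only the increment of the summand j = 0 is kept. It does not depend on n, so strict monotonicity
    survives the limit. *)
Lemma theta_n_increment q n x y : 0 < q < 1 -> x <= y ->
  atf (cq q 0) y - atf (cq q 0) x <= theta_n q n y - theta_n q n x.
Proof.
  intros hq hxy. unfold theta_n, gsum. rewrite <- sum_n_Rminus.
  apply (sum_n_ge_term (fun k => atf (cq q k) y - atf (cq q k) x)); [|lia].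
  intros k. unfold atf. assert (hc := cq_pos q k hq).
  destruct (Req_dec x y) as [->|hne]; [lra|].
  assert (h : cq q k * x < cq q k * y) by nra.
  apply atan_increasing in h; lra.
Qed.

Lemma theta_n_lim q x : 0 < q < 1 -> is_lim_seq (fun n => theta_n q n x) (theta q x).
Proof. intros hq. apply gsum_lim; [apply atf_lipschitz|easy]. Qed.

Lemma theta_increment q x y : 0 < q < 1 -> x <= y ->
  atf (cq q 0) y - atf (cq q 0) x <= theta q y - theta q x.
Proof.
  intros hq hxy.
  exact (is_lim_seq_le _ _ _ _ (fun n => theta_n_increment q n x y hq hxy)
           (is_lim_seq_const _)
           (is_lim_seq_minus' _ _ _ _ (theta_n_lim q y hq) (theta_n_lim q x hq))).
Qed.

Lemma atf_increasing c x y : 0 < c -> x < y -> atf c x < atf c y.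
Proof. intros hc hxy. apply atan_increasing. nra. Qed.

Lemma theta_n_increasing q n x y : 0 < q < 1 -> x < y -> theta_n q n x < theta_n q n y.
Proof.
  intros hq hxy. assert (h := theta_n_increment q n x y hq (Rlt_le _ _ hxy)).
  assert (h' := atf_increasing _ x y (cq_pos q 0 hq) hxy). lra.
Qed.

Lemma theta_increasing q x y : 0 < q < 1 -> x < y -> theta q x < theta q y.
Proof.
  intros hq hxy. assert (h := theta_increment q x y hq (Rlt_le _ _ hxy)).
  assert (h' := atf_increasing _ x y (cq_pos q 0 hq) hxy). lra.
Qed.

Lemma theta_n_0 q n : theta_n q n 0 = 0.
Proof.
  unfold theta_n, gsum. rewrite (sum_n_ext _ (fun _ => 0)).
  - rewrite sum_n_const; ring.
  - intros j. unfold atf. now rewrite Rmult_0_r, atan_0.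
Qed.

Lemma theta_0 q : theta q 0 = 0.
Proof.
  unfold theta, gser. rewrite (Series_ext _ (fun _ => 0 * 0)).
  - rewrite Series_scal_l; ring.
  - intros j. unfold atf. rewrite Rmult_0_r, atan_0. ring.
Qed.

Lemma atf_nonneg c x : 0 < c -> 0 <= x -> 0 <= atf c x.
Proof.
  intros hc hx. destruct (Req_dec x 0) as [->|hne].
  - unfold atf; rewrite Rmult_0_r, atan_0; lra.
  - assert (h := atf_increasing c 0 x hc ltac:(lra)).
    unfold atf at 1 in h; rewrite Rmult_0_r, atan_0 in h; lra.
Qed.

Lemma theta_n_le_theta q n x : 0 < q < 1 -> 0 <= x -> theta_n q n x <= theta q x.
Proof.
  intros hq hx.
  apply (is_lim_seq_incr_compare (fun n => theta_n q n x) (theta q x)); [now apply theta_n_lim|].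
  intros m. unfold theta_n, gsum. rewrite sum_Sn. change plus with Rplus.
  assert (h := atf_nonneg (cq q (S m)) x (cq_pos q (S m) hq) hx). lra.
Qed.

Lemma theta_n_le_self q n x : 0 < q < 1 -> 0 <= x -> theta_n q n x <= x.
Proof.
  intros hq hx. assert (h := gsum_lipschitz atf q n 0 x atf_lipschitz hq).
  fold (theta_n q n x) in h. fold (theta_n q n 0) in h.
  rewrite theta_n_0, !Rminus_0_r, (Rabs_pos_eq x) in h by easy.
  apply Rle_trans with (2 := h). apply Rle_abs.
Qed.

Lemma theta_le_self q x : 0 < q < 1 -> 0 <= x -> theta q x <= x.
Proof.
  intros hq hx.
  exact (is_lim_seq_le _ _ _ _ (fun n => theta_n_le_self q n x hq hx)
           (theta_n_lim q x hq) (is_lim_seq_const _)).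
Qed.

Lemma continuity_theta_n q n : 0 < q < 1 -> continuity (theta_n q n).
Proof.
  intros hq x. apply derivable_continuous_pt.
  exists (gsum datf q n x). now apply is_derive_Reals, is_derive_theta_n.
Qed.

Lemma continuity_theta q : 0 < q < 1 -> continuity (theta q).
Proof.
  intros hq x. apply derivable_continuous_pt.
  exists (gser datf q x). now apply is_derive_Reals, is_derive_theta.
Qed.

Lemma theta_n_root q n t : 0 < q < 1 -> 0 < t < INR (S n) * (PI / 2) ->
  {x : R | 0 < x /\ theta_n q n x = t}.
Proof.
  intros hq [ht1 ht2].
  assert (hn : 0 < INR (S n)) by apply lt_0_INR, Nat.lt_0_succ.
  assert (hP := PI_RGT_0).
  set (a := t / INR (S n)).
  assert (ha : 0 < a < PI / 2).
  { unfold a; split; [now apply Rdiv_lt_0_compat | apply Rlt_div_l; [easy|lra]]. }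
  assert (hta : 0 < tan a) by (apply tan_gt_0; lra).
  assert (hc := cq_pos q n hq).
  (* At X even the flattest summand, with c_n, reaches a = t / (n + 1); all n + 1 summands together
     reach t. *)
  set (X := tan a / cq q n).
  assert (hX : 0 < X) by now apply Rdiv_lt_0_compat.
  assert (hge : t <= theta_n q n X).
  { assert (e : t = sum_n (fun _ => a) n) by (rewrite sum_n_const; unfold a; field; lra).
    rewrite e.
    apply sum_n_le.
    intros k hk. rewrite <- (atan_tan a) at 1 by lra. unfold atf.
    assert (h : tan a <= cq q k * X).
    { unfold X. apply Rmult_le_reg_r with (cq q n); [easy|].
      unfold Rdiv. rewrite <- Rmult_assoc, Rmult_assoc, Rinv_l, Rmult_1_r by lra.
      rewrite Rmult_comm. apply Rmult_le_compat_r; [lra|]. apply cq_decreasing; [easy|lia]. }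
    destruct h as [h|h]; [left; now apply atan_increasing | rewrite h; lra]. }
  destruct (IVT_gen (theta_n q n) 0 X t) as (x & hx & e).
  - now apply continuity_theta_n.
  - rewrite theta_n_0. rewrite Rmin_left, Rmax_right by lra. lra.
  - exists x. split; [|easy]. rewrite Rmin_left in hx by lra.
    destruct (Req_dec x 0) as [->|]; [rewrite theta_n_0 in e|]; lra.
Qed.

(** Asks only for a point where theta has already passed t; in [zeros_phases] such a point is
    supplied by a given zero. *)
Lemma theta_root_le q t X : 0 < q < 1 -> 0 < X -> 0 < t <= theta q X ->
  exists x, 0 < x <= X /\ theta q x = t.
Proof.
  intros hq hX ht. destruct (IVT_gen (theta q) 0 X t) as (x & hx & e).
  - now apply continuity_theta.
  - rewrite theta_0. rewrite Rmin_left, Rmax_right by lra. lra.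
  - exists x. rewrite Rmin_left, Rmax_right in hx by lra. split; [|easy].
    destruct (Req_dec x 0) as [->|]; [rewrite theta_0 in e|]; lra.
Qed.

(* The first k terms of theta contribute at most k pi / 2 and the others at most q^k x. *)
Lemma theta_n_upper q n k x : 0 < q < 1 -> 0 <= x -> (k <= n)%nat ->
  theta_n q n x <= INR k * (PI / 2) + q ^ k * x.
Proof.
  intros hq hx hk.
  assert (hj : forall j, atf (cq q j) x <= PI / 2).
  { intros j; unfold atf. left. apply atan_bound. }
  assert (hj' : forall j, atf (cq q j) x <= cq q j * x).
  { intros j. destruct atf_lipschitz as [_ h].
    specialize (h (cq q j) 0 x (conj (cq_pos q j hq) (cq_lt_1 q j hq))).
    unfold atf at 2 in h. rewrite Rmult_0_r, atan_0, !Rminus_0_r, (Rabs_pos_eq x) in h by easy.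
    apply Rle_trans with (2 := h). apply Rle_abs. }
  assert (H : theta_n q n x <= INR k * (PI / 2) + (q ^ k - q ^ S n) * x).
  { induction hk as [|n hk IH].
    - destruct k as [|k].
      + unfold theta_n, gsum. rewrite sum_O. specialize (hj' O). unfold cq at 2 in hj'.
        simpl in *. lra.
      + assert (IH : theta_n q k x <= INR (S k) * (PI / 2)).
        { unfold theta_n, gsum. rewrite <- sum_n_const. apply sum_n_le. intros; apply hj. }
        unfold theta_n, gsum in *. rewrite sum_Sn. change plus with Rplus.
        specialize (hj' (S k)). unfold cq at 2 in hj'.
        replace (q ^ S k - q ^ S (S k)) with ((1 - q) * q ^ S k) by (simpl; ring). lra.
    - unfold theta_n, gsum in *. rewrite sum_Sn. change plus with Rplus.
      specialize (hj' (S n)). unfold cq at 2 in hj'.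
      replace (q ^ k - q ^ S (S n)) with ((q ^ k - q ^ S n) + (1 - q) * q ^ S n) by (simpl; ring).
      lra. }
  assert (h : 0 < q ^ S n) by (apply pow_lt; lra). nra.
Qed.

(** Of a phase of at least (k + 1/2) pi, the first k arctangents account for at most k pi / 2. The
    rest, at most q^k x, has to supply (k + 1) pi / 2, which exceeds 1. *)
Lemma root_lower q n k x t : 0 < q < 1 -> 0 <= x -> (k <= n)%nat ->
  theta_n q n x = t -> (INR k + / 2) * PI <= t -> 1 <= q ^ k * x.
Proof.
  intros hq hx hk e ht. assert (h := theta_n_upper q n k x hq hx hk).
  assert (hP : 2 < PI) by (assert (h' := PI2_1); lra).
  assert (hI := pos_INR k). nra.
Qed.

Lemma root_lower_limit q k x t : 0 < q < 1 -> 0 <= x ->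
  theta q x = t -> (INR k + / 2) * PI <= t -> 1 <= q ^ k * x.
Proof.
  intros hq hx e ht.
  assert (h : theta q x <= INR k * (PI / 2) + q ^ k * x).
  { apply (is_lim_seq_le (fun n => theta_n q (n + k) x) (fun _ => INR k * (PI / 2) + q ^ k * x)
             (theta q x) (INR k * (PI / 2) + q ^ k * x)).
    - intros n. apply theta_n_upper; [easy|easy|lia].
    - apply (is_lim_seq_incr_n (fun n => theta_n q n x) k). now apply theta_n_lim.
    - apply is_lim_seq_const. }
  assert (hP : 2 < PI) by (assert (h' := PI2_1); lra).
  assert (hI := pos_INR k). nra.
Qed.

Lemma datf_pos c x : 0 < c -> 0 < datf c x.
Proof. intros hc. unfold datf. assert (h := pow2_ge_0 (c * x)). apply Rdiv_lt_0_compat; lra. Qed.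

Lemma dtheta_n_ge q n j x : 0 < q < 1 -> (j <= n)%nat -> datf (cq q j) x <= gsum datf q n x.
Proof.
  intros hq hj. apply (sum_n_ge_term (fun j => datf (cq q j) x)); [|easy].
  intros k. left. apply datf_pos. now apply cq_pos.
Qed.

Lemma dtheta_n_pos q n x : 0 < q < 1 -> 0 < gsum datf q n x.
Proof.
  intros hq. eapply Rlt_le_trans; [|apply (dtheta_n_ge q n 0 x hq); lia].
  apply datf_pos, cq_pos, hq.
Qed.

Lemma dtheta_ge q j x : 0 < q < 1 -> datf (cq q j) x <= gser datf q x.
Proof.
  intros hq.
  apply (is_lim_seq_le (fun _ => datf (cq q j) x) (fun n => gsum datf q (n + j) x)
             (datf (cq q j) x) (gser datf q x)).
  - intros n. apply dtheta_n_ge; [easy|lia].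
  - apply is_lim_seq_const.
  - apply (is_lim_seq_incr_n (fun n => gsum datf q n x) j).
    apply gsum_lim; [apply datf_lipschitz|easy].
Qed.

Lemma dtheta_pos q x : 0 < q < 1 -> 0 < gser datf q x.
Proof.
  intros hq. eapply Rlt_le_trans; [|apply (dtheta_ge q 0 x hq)].
  apply datf_pos, cq_pos, hq.
Qed.

Definition wbound (q : R) : R := / (1 - q) + (1 - q).

(** The k-th summand of theta' alone suffices: its reciprocal is 1 / ((1 - q) q^k) + (1 - q) q^k
    x^2, and q^k x >= 1 turns q^(-k) into at most q^k x^2. The two coefficients add up to
    [wbound]. *)
Lemma weight_bound q k x d : 0 < q < 1 -> 1 <= q ^ k * x -> datf (cq q k) x <= d ->
  / d <= wbound q * q ^ k * x ^ 2.
Proof.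
  intros hq hx hd.
  assert (hk : 0 < q ^ k) by (apply pow_lt; lra).
  assert (hc := cq_pos q k hq).
  assert (hp := datf_pos (cq q k) x hc).
  eapply Rle_trans; [apply Rinv_le_contravar; eassumption|].
  unfold datf, cq, wbound. set (p := q ^ k) in *.
  assert (hs := pow2_ge_0 ((1 - q) * p * x)).
  replace (/ ((1 - q) * p / (1 + ((1 - q) * p * x) ^ 2)))
    with (/ (1 - q) * / p + (1 - q) * p * x ^ 2) by (field; lra).
  assert (h1 : / p <= p * x ^ 2).
  { apply Rmult_le_reg_l with p; [easy|]. rewrite Rinv_r by lra.
    replace (p * (p * x ^ 2)) with ((p * x) ^ 2) by ring.
    assert (h : 1 ^ 2 <= (p * x) ^ 2) by (apply pow_incr; lra). lra. }
  assert (h2 : 0 < / (1 - q)) by (apply Rinv_0_lt_compat; lra).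
  assert (h3 : / (1 - q) * / p <= / (1 - q) * (p * x ^ 2)) by (apply Rmult_le_compat_l; lra).
  lra.
Qed.

(** Both bounds come from the factor |1 + i c_0 x|, the others being at least 1. The second one
    absorbs the extra factor r in the residues of 1 / Cos_q. *)
Lemma rho_n_ge q n x : 0 < q < 1 -> 1 <= rho_n q n x /\ cq q 0 * Rabs x <= rho_n q n x.
Proof.
  intros hq. unfold rho_n.
  assert (hnn : forall k, 0 <= lnf (cq q k) x).
  { intros k. unfold lnf. assert (h := pow2_ge_0 (cq q k * x)).
    assert (h' : ln 1 <= ln (1 + (cq q k * x) ^ 2)) by (apply ln_le; lra).
    rewrite ln_1 in h'. lra. }
  assert (hge : lnf (cq q 0) x <= gsum lnf q n x)
    by (apply (sum_n_ge_term (fun j => lnf (cq q j) x)); [easy|lia]).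
  assert (h1 : exp (lnf (cq q 0) x) <= exp (gsum lnf q n x)).
  { destruct hge as [h|h]; [left; now apply exp_increasing | rewrite h; lra]. }
  assert (h2 := polar_factor (cq q 0 * x)).
  fold (lnf (cq q 0) x) in h2. destruct h2 as [h2 h3].
  assert (hp := exp_pos (lnf (cq q 0) x)).
  split.
  - eapply Rle_trans; [|apply h1].
    destruct (COS_bound (atan (cq q 0 * x))) as [_ hb]. nra.
  - eapply Rle_trans; [|apply h1].
    replace (cq q 0 * Rabs x) with (Rabs (cq q 0 * x))
      by (rewrite Rabs_mult, (Rabs_pos_eq (cq q 0)); [easy | left; now apply cq_pos]).
    rewrite <- h3, Rabs_mult, (Rabs_pos_eq (exp _)) by lra.
    assert (Rabs (sin (atan (cq q 0 * x))) <= 1) by (apply Rabs_le_between, SIN_bound).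
    nra.
Qed.

Lemma rho_n_lim q x : 0 < q < 1 -> is_lim_seq (fun n => rho_n q n x) (rho q x).
Proof.
  intros hq. apply (rho_n_lim_moving q (fun _ => x) (fun n => n) x hq (filterlim_id _ _)
                  (is_lim_seq_const _)).
Qed.

Lemma rho_ge q x : 0 < q < 1 -> 1 <= rho q x /\ cq q 0 * Rabs x <= rho q x.
Proof.
  intros hq. split.
  - exact (is_lim_seq_le _ _ _ _ (fun n => proj1 (rho_n_ge q n x hq))
           (is_lim_seq_const _) (rho_n_lim q x hq)).
  - exact (is_lim_seq_le _ _ _ _ (fun n => proj2 (rho_n_ge q n x hq))
           (is_lim_seq_const _) (rho_n_lim q x hq)).
Qed.

(** Truncated phases lie below theta, so their roots are never to the left of x. They are eventually
    left of x + eps, because the truncated phase there converges to a value above t. *)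
Lemma roots_converge q (nn : nat -> nat) (r : nat -> R) (x t : R) : 0 < q < 1 ->
  filterlim nn eventually eventually -> 0 < x -> theta q x = t ->
  eventually (fun m => 0 < r m /\ theta_n q (nn m) (r m) = t) ->
  is_lim_seq r x.
Proof.
  intros hq hn hx ht hr. apply is_lim_seq_spec. intros eps.
  assert (he := cond_pos eps).
  assert (hlt : t < theta q (x + eps)) by (rewrite <- ht; apply theta_increasing; [easy|lra]).
  assert (hlim : is_lim_seq (fun m => theta_n q (nn m) (x + eps)) (theta q (x + eps))).
  { apply (is_lim_seq_subseq (fun n => theta_n q n (x + eps))); [easy | now apply theta_n_lim]. }
  apply is_lim_seq_spec in hlim.
  destruct (hlim (mkposreal (theta q (x + eps) - t) ltac:(lra))) as [N1 H1]. simpl in H1.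
  destruct hr as [N2 H2].
  exists (N1 + N2)%nat. intros m hm.
  specialize (H1 m ltac:(lia)). destruct (H2 m ltac:(lia)) as [hpos e].
  apply Rabs_def2 in H1.
  apply Rabs_def1.
  - destruct (Rlt_or_le (r m) (x + eps)) as [h|h]; [lra|].
    destruct h as [h|h].
    + assert (h' := theta_n_increasing q (nn m) _ _ hq h). lra.
    + rewrite <- h in e. lra.
  - destruct (Rlt_or_le (r m) x) as [h|h]; [|lra].
    assert (h' := theta_increasing q _ _ hq h).
    assert (h2 := theta_n_le_theta q (nn m) (r m) hq ltac:(lra)). lra.
Qed.

(** * Partial fractions and Tannery's theorem *)

(** Polynomial functions of degree less than n in Horner form. A degree bound on functions is all
    that interpolation requires. *)
Fixpoint poly_lt (n : nat) (f : R -> R) : Prop :=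
  match n with
  | O => forall x, f x = 0
  | S m => exists a g, poly_lt m g /\ forall x, f x = a + x * g x
  end.

Lemma poly_lt_ext n f g : (forall x, f x = g x) -> poly_lt n f -> poly_lt n g.
Proof.
  destruct n as [|n]; simpl.
  - intros H H' x; now rewrite <- H.
  - intros H (a & h & hh & e). exists a, h; split; [easy|]. intros x; now rewrite <- H.
Qed.

Lemma poly_lt_zero n : poly_lt n (fun _ => 0).
Proof.
  induction n as [|n IH]; simpl; [easy|]. exists 0, (fun _ => 0); split; [easy|]. intros; ring.
Qed.

Lemma poly_lt_lincomb n a b f g : poly_lt n f -> poly_lt n g ->
  poly_lt n (fun x => a * f x + b * g x).
Proof.
  revert f g; induction n as [|n IH]; simpl; intros f g.
  - intros hf hg x; rewrite hf, hg; ring.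
  - intros (u & f' & hf & ef) (v & g' & hg & eg).
    exists (a * u + b * v), (fun x => a * f' x + b * g' x). split; [now apply IH|].
    intros x; rewrite ef, eg; ring.
Qed.

Lemma poly_lt_S n f : poly_lt n f -> poly_lt (S n) f.
Proof.
  revert f; induction n as [|n IH]; intros f.
  - intros hf. exists 0, (fun _ => 0). split; [easy|]. intros x; rewrite hf; ring.
  - intros (a & g & hg & e). exists a, g; split; [now apply IH|easy].
Qed.

Lemma poly_lt_mul_x n f : poly_lt n f -> poly_lt (S n) (fun x => x * f x).
Proof. intros hf. exists 0, f. split; [easy|]. intros; ring. Qed.

Lemma poly_lt_one n : poly_lt (S n) (fun _ => 1).
Proof. exists 1, (fun _ => 0). split; [apply poly_lt_zero|]. intros; ring. Qed.

Lemma poly_lt_sum n m (F : nat -> R -> R) :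
  (forall k, (k <= m)%nat -> poly_lt n (F k)) -> poly_lt n (fun x => sum_n (fun k => F k x) m).
Proof.
  induction m as [|m IH]; intros H.
  - apply poly_lt_ext with (F O); [intros; now rewrite sum_O | apply H; lia].
  - apply poly_lt_ext with (fun x => 1 * sum_n (fun k => F k x) m + 1 * F (S m) x).
    + intros; rewrite sum_Sn. change plus with Rplus. ring.
    + apply poly_lt_lincomb; [apply IH; intros; apply H; lia | apply H; lia].
Qed.

Lemma poly_lt_factor n f r : poly_lt (S n) f ->
  exists g, poly_lt n g /\ forall x, f x = f r + (x - r) * g x.
Proof.
  revert f; induction n as [|n IH]; intros f (a & g & hg & e).
  - exists (fun _ => 0). split; [easy|]. intros x. rewrite (e x), (e r), !hg. ring.
  - destruct (IH g hg) as (h & hh & eh).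
    (* From x g(x) - r g(r) = (x - r) g(x) + r (g(x) - g(r)), where the last difference is (x - r)
       h(x). *)
    exists (fun x => 1 * g x + r * h x). split.
    + apply poly_lt_lincomb; [easy | now apply poly_lt_S].
    + intros x. rewrite (e x), (e r), (eh x). ring.
Qed.

Lemma poly_lt_ex_derive n f x : poly_lt n f -> ex_derive f x.
Proof.
  revert f; induction n as [|n IH]; intros f.
  - intros hf. apply ex_derive_ext with (fun _ => 0); [intros; now rewrite hf|].
    apply ex_derive_const.
  - intros (a & g & hg & e). apply ex_derive_ext with (fun x => a + x * g x); [easy|].
    specialize (IH g hg). now auto_derive.
Qed.

Lemma poly_lt_root_zero n f (u : nat -> R) : poly_lt n f ->
  (forall i j, (i < n)%nat -> (j < n)%nat -> i <> j -> u i <> u j) ->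
  (forall k, (k < n)%nat -> f (u k) = 0) -> forall x, f x = 0.
Proof.
  revert f; induction n as [|n IH]; intros f hf hu hz; [easy|].
  destruct (poly_lt_factor n f (u n) hf) as (g & hg & e).
  assert (hg0 : forall x, g x = 0).
  { apply IH; [easy | intros; apply hu; lia |].
    intros k hk. assert (h := e (u k)). rewrite !hz in h by lia.
    assert (u k <> u n) by (apply hu; lia).
    apply Rmult_eq_reg_l with (u k - u n); lra. }
  intros x. rewrite e, hz, hg0 by lia. ring.
Qed.

Lemma sum_n_single (a : nat -> R) j n : (j <= n)%nat ->
  (forall k, (k <= n)%nat -> k <> j -> a k = 0) -> sum_n a n = a j.
Proof.
  intros hj H. induction n as [|n IH].
  - replace j with O by lia. now rewrite sum_O.
  - rewrite sum_Sn. change plus with Rplus. destruct (Nat.eq_dec j (S n)) as [->|hne].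
    + rewrite (sum_n_ext_loc _ (fun _ => 0)); [|intros; apply H; lia].
      rewrite sum_n_const. real_eq. ring.
    + rewrite IH, (H (S n)); [real_eq; ring|lia|lia|lia|intros; apply H; lia].
Qed.

Lemma finite_choice (P : nat -> (R -> R) -> Prop) m :
  (forall k, (k <= m)%nat -> exists g, P k g) ->
  exists G, forall k, (k <= m)%nat -> P k (G k).
Proof.
  induction m as [|m IH]; intros H.
  - destruct (H O ltac:(lia)) as [g hg]. exists (fun _ => g). intros k hk.
    now replace k with O by lia.
  - destruct IH as [G hG]; [intros; apply H; lia|].
    destruct (H (S m) ltac:(lia)) as [g hg].
    exists (fun k => if Nat.eq_dec k (S m) then g else G k). intros k hk.
    destruct (Nat.eq_dec k (S m)) as [->|hne]; [easy | apply hG; lia].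
Qed.

(** With s(x) = (x - u_k) G_k(x) one has G_k(u_k) = s'(u_k), and G_k vanishes at the other nodes. So
    the sum of p(u_k) / s'(u_k) G_k is the Lagrange interpolant of p at m + 1 nodes, hence equal to
    p. *)
Lemma partial_fractions_proper m p s (u : nat -> R) :
  poly_lt (S m) p -> poly_lt (S (S m)) s ->
  (forall i j, (i <= m)%nat -> (j <= m)%nat -> i <> j -> u i <> u j) ->
  (forall k, (k <= m)%nat -> s (u k) = 0 /\ Derive s (u k) <> 0) ->
  forall v, s v <> 0 ->
  p v / s v = sum_n (fun k => p (u k) / Derive s (u k) / (v - u k)) m.
Proof.
  intros hp hs hu hz v hv.
  destruct (finite_choice (fun k g => poly_lt (S m) g /\ forall x, s x = (x - u k) * g x) m)
    as [G hG].
  { intros k hk. destruct (poly_lt_factor _ s (u k) hs) as (g & hg & e).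
    exists g; split; [easy|]. intros x. rewrite e, (proj1 (hz k hk)). ring. }
  assert (hd : forall k, (k <= m)%nat -> G k (u k) = Derive s (u k)).
  { intros k hk. destruct (hG k hk) as [hg e]. symmetry.
    rewrite (Derive_ext s (fun x => (x - u k) * G k x)) by apply e.
    assert (hex := poly_lt_ex_derive _ _ (u k) hg).
    apply is_derive_unique. auto_derive; [easy|]. ring. }
  assert (hpoly : forall x, p x - sum_n (fun k => p (u k) / Derive s (u k) * G k x) m = 0).
  { apply (poly_lt_root_zero (S m)) with (u := u).
    - apply poly_lt_ext with
        (* The summand 0 G_k only gives the scalar multiple the shape that [poly_lt_lincomb]
           accepts. *)
        (fun x => 1 * p x + -1 * sum_n (fun k => p (u k) / Derive s (u k) * G k x + 0 * G k x) m).
      + intros x. rewrite (sum_n_ext _ (fun k => p (u k) / Derive s (u k) * G k x)); [ring|].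
        intros; real_eq; ring.
      + apply poly_lt_lincomb; [easy|]. apply poly_lt_sum with
          (F := fun k x => p (u k) / Derive s (u k) * G k x + 0 * G k x).
        intros k hk. apply poly_lt_lincomb; now apply hG.
    - intros; apply hu; lia.
    - intros j hj. rewrite (sum_n_single _ j); [|lia|].
      + rewrite hd by lia. field. apply hz; lia.
      + intros k hk hne. destruct (hG k hk) as [_ e].
        assert (h := e (u j)). rewrite (proj1 (hz j ltac:(lia))) in h.
        assert (u j <> u k) by (apply hu; lia).
        assert (hzero : G k (u j) = 0) by (apply Rmult_eq_reg_l with (u j - u k); lra).
        rewrite hzero; ring. }
  specialize (hpoly v).
  replace (p v) with (sum_n (fun k => p (u k) / Derive s (u k) * G k v) m) by lra.
  unfold Rdiv at 1. rewrite <- sum_n_Rmult_r. apply sum_n_ext_loc. intros k hk.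
  destruct (hG k hk) as [_ e]. rewrite (e v) in hv |- *.
  assert (v - u k <> 0) by (intros h; apply hv; rewrite h; ring).
  assert (G k v <> 0) by (intros h; apply hv; rewrite h; ring).
  real_eq; field. split; [|split]; try easy. apply hz; lia.
Qed.

(** When p may have the degree of s, the value at 0 is split off: p - (p(0) / s(0)) s is divisible
    by x, and the quotient over s is proper. The subtraction also provides the additional 1 / u_k
    that makes the limit series converge. *)
Lemma partial_fractions m p s (u : nat -> R) :
  poly_lt (S (S m)) p -> poly_lt (S (S m)) s -> s 0 <> 0 ->
  (forall i j, (i <= m)%nat -> (j <= m)%nat -> i <> j -> u i <> u j) ->
  (forall k, (k <= m)%nat -> s (u k) = 0 /\ Derive s (u k) <> 0) ->
  forall v, s v <> 0 ->
  p v / s v = p 0 / s 0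
     + v * sum_n (fun k => p (u k) / (u k * Derive s (u k)) / (v - u k)) m.
Proof.
  intros hp hs h0 hu hz v hv.
  destruct (poly_lt_factor _ (fun x => 1 * p x + - (p 0 / s 0) * s x) 0
              (poly_lt_lincomb _ _ _ _ _ hp hs)) as (g & hg & e).
  assert (e' : forall x, p x = p 0 / s 0 * s x + x * g x).
  { intros x. specialize (e x). replace (1 * p 0 + - (p 0 / s 0) * s 0) with 0 in e by (field; easy).
    lra. }
  rewrite (e' v) at 1.
  replace ((p 0 / s 0 * s v + v * g v) / s v) with (p 0 / s 0 + v * (g v / s v)) by (field; easy).
  f_equal. f_equal.
  rewrite (partial_fractions_proper m g s u hg hs hu hz v hv).
  apply sum_n_ext_loc. intros k hk. destruct (hz k hk) as [hz1 hz2].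
  rewrite (e' (u k)), hz1.
  assert (u k <> 0) by (intros h; rewrite h in hz1; easy).
  assert (v - u k <> 0).
  { intros h. apply hv. replace v with (u k) by lra. easy. }
  real_eq; field. easy.
Qed.

Lemma is_lim_seq_sum_n (F : nat -> nat -> R) (f : nat -> R) K :
  (forall k, is_lim_seq (fun m => F m k) (f k)) ->
  is_lim_seq (fun m => sum_n (F m) K) (sum_n f K).
Proof.
  intros H. induction K as [|K IH].
  - apply is_lim_seq_ext with (fun m => F m O); [intros; now rewrite sum_O|].
    rewrite sum_O; apply H.
  - apply is_lim_seq_ext with (fun m => sum_n (F m) K + F m (S K)).
    + intros m; now rewrite sum_Sn.
    + rewrite sum_Sn. now apply is_lim_seq_plus'.
Qed.

Lemma ex_series_geometric_bound (a : nat -> R) (B q : R) :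
  0 < q < 1 -> (forall k, Rabs (a k) <= B * q ^ k) -> ex_series a.
Proof.
  intros hq H.
  apply (ex_series_le (K := R_AbsRing) (V := R_CompleteNormedModule) _ (fun k => B * q ^ k)).
  - exact H.
  - apply (ex_series_scal (V := R_NormedModule)). apply ex_series_geom.
    rewrite Rabs_pos_eq; lra.
Qed.

Lemma Rabs_Series_geometric_bound (a : nat -> R) (B q : R) :
  0 < q < 1 -> (forall k, Rabs (a k) <= B * q ^ k) -> Rabs (Series a) <= B / (1 - q).
Proof.
  intros hq H.
  assert (hex : ex_series (fun k => Rabs (a k))).
  { apply ex_series_geometric_bound with B q; [easy|]. intros; now rewrite Rabs_Rabsolu. }
  eapply Rle_trans; [apply Series_Rabs, hex|].
  eapply Rle_trans.
  - apply (Series_le _ (fun k => B * q ^ k)).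
    + intros k; split; [apply Rabs_pos | apply H].
    + apply (ex_series_scal (V := R_NormedModule)). apply ex_series_geom.
      rewrite Rabs_pos_eq; lra.
  - rewrite Series_scal_l, Series_geom by (rewrite Rabs_pos_eq; lra). right; easy.
Qed.

Lemma sum_geom_tail (q : R) K m : 0 < q < 1 -> (K <= m)%nat ->
  sum_n (fun k => q ^ k) m <= sum_n (fun k => q ^ k) K + q ^ K / (1 - q).
Proof.
  intros hq hK.
  assert (h : forall n, sum_n (fun k => q ^ k) n = (1 - q ^ S n) / (1 - q)).
  { intros n. induction n as [|n IH].
    - rewrite sum_O; simpl; field; lra.
    - rewrite sum_Sn, IH. change plus with Rplus. simpl; field; lra. }
  rewrite !h. unfold Rdiv. rewrite <- Rmult_plus_distr_r.
  apply Rmult_le_compat_r; [left; apply Rinv_0_lt_compat; lra|].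
  assert (h1 : 0 < q ^ S m) by (apply pow_lt; lra).
  assert (h2 : 0 < q ^ K) by (apply pow_lt; lra). simpl in *; nra.
Qed.

(** Dominated convergence for sums whose length grows with m. The head up to K converges termwise;
    the tail is bounded geometrically, uniformly in m. *)
Lemma tannery (F : nat -> nat -> R) (f : nat -> R) (B q : R) :
  0 < q < 1 -> 0 <= B ->
  (forall m k, (k <= m)%nat -> Rabs (F m k) <= B * q ^ k) ->
  (forall k, is_lim_seq (fun m => F m k) (f k)) ->
  (forall k, Rabs (f k) <= B * q ^ k) /\
  is_lim_seq (fun m => sum_n (F m) m) (Series f).
Proof.
  intros hq hB hb hl.
  assert (hf : forall k, Rabs (f k) <= B * q ^ k).
  { intros k.
    apply (is_lim_seq_le_loc (fun m => Rabs (F m k)) (fun _ => B * q ^ k)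
             (Rabs (f k)) (B * q ^ k)).
    - exists k. intros m hm; now apply hb.
    - now apply (is_lim_seq_abs _ (Finite _)).
    - apply is_lim_seq_const. }
  split; [easy|].
  assert (hs : is_lim_seq (sum_n f) (Series f)).
  { apply Series_correct. now apply ex_series_geometric_bound with B q. }
  apply is_lim_seq_ext with (fun m => sum_n f m + (sum_n (F m) m - sum_n f m)).
  { intros; ring. }
  replace (Series f) with (Series f + 0) by ring.
  apply is_lim_seq_plus'; [easy|].
  (* Nothing is assumed about [F m k] for k > m; replacing the error there by 0 makes the geometric
     bound valid for all k. *)
  set (G := fun m k => if Compare_dec.le_dec k m then Rabs (F m k - f k) else 0).
  assert (hG0 : forall m k, 0 <= G m k).
  { intros m k; unfold G; destruct (Compare_dec.le_dec k m); [apply Rabs_pos | lra]. }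
  assert (hGb : forall m k, G m k <= 2 * B * q ^ k).
  { intros m k; unfold G. assert (0 < q ^ k) by (apply pow_lt; lra).
    destruct (Compare_dec.le_dec k m).
    - unfold Rminus. eapply Rle_trans; [apply Rabs_triang|]. rewrite Rabs_Ropp.
      specialize (hb m k ltac:(easy)). specialize (hf k). lra.
    - assert (0 <= B * q ^ k) by (apply Rmult_le_pos; lra). lra. }
  assert (hGl : forall k, is_lim_seq (fun m => G m k) 0).
  { intros k. apply is_lim_seq_ext_loc with (fun m => Rabs (F m k - f k)).
    - exists k. intros m hm. unfold G. destruct (Compare_dec.le_dec k m); [easy | lia].
    - apply -> is_lim_seq_abs_0. replace 0 with (f k - f k) by ring.
      apply is_lim_seq_minus'; [easy | apply is_lim_seq_const]. }
  apply is_lim_seq_spec. intros eps. assert (he := cond_pos eps).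
  assert (hgeo : is_lim_seq (fun K => 2 * B * (q ^ K / (1 - q))) 0).
  { replace (Finite 0) with (Rbar_mult (2 * B) (Rbar_mult 0 (/ (1 - q)))) by (simpl; f_equal; ring).
    apply is_lim_seq_scal_l. apply is_lim_seq_scal_r. apply is_lim_seq_geom.
    rewrite Rabs_pos_eq; lra. }
  apply is_lim_seq_spec in hgeo. destruct (hgeo (pos_div_2 eps)) as [K hK].
  specialize (hK K (le_n K)). simpl in hK. rewrite Rminus_0_r in hK.
  assert (hfin : is_lim_seq (fun m => sum_n (G m) K) 0).
  { assert (e : Finite 0 = Finite (sum_n (fun _ => 0) K))
      by (rewrite sum_n_const; f_equal; ring).
    rewrite e. now apply is_lim_seq_sum_n with (f := fun _ => 0). }
  apply is_lim_seq_spec in hfin. destruct (hfin (pos_div_2 eps)) as [M hM].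
  exists (K + M)%nat. intros m hm. specialize (hM m ltac:(lia)). simpl in hM.
  rewrite Rminus_0_r in hM |- *.
  rewrite <- sum_n_Rminus.
  apply Rle_lt_trans with (sum_n (G m) m).
  { apply sum_n_Rabs_le. intros k hk. unfold G. destruct (Compare_dec.le_dec k m); [lra|lia]. }
  assert (htail : sum_n (G m) m <= sum_n (G m) K + 2 * B * (q ^ K / (1 - q))).
  { destruct (Nat.eq_dec K m) as [->|hne].
    - assert (0 <= q ^ m / (1 - q)) by (apply Rdiv_le_0_compat; [left; apply pow_lt; lra | lra]).
      nra.
    - assert (e1 : forall a : nat -> R, sum_n a m = sum_n a K + sum_n_m a (S K) m).
      { intros a. unfold sum_n. rewrite (sum_n_m_Chasles a 0 K m) by lia. easy. }
      rewrite e1. apply Rplus_le_compat_l.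
      apply Rle_trans with (sum_n_m (fun k => 2 * B * q ^ k) (S K) m);
        [apply sum_n_m_le; intros; apply hGb|].
      assert (h := sum_geom_tail q K m hq ltac:(lia)).
      assert (e2 := e1 (fun k => q ^ k)).
      assert (e3 : sum_n_m (fun k => 2 * B * q ^ k) (S K) m
                   = 2 * B * sum_n_m (fun k => q ^ k) (S K) m)
        by exact (sum_n_m_mult_l (2 * B) (fun k => q ^ k) (S K) m).
      rewrite e3. apply Rmult_le_compat_l; lra. }
  apply Rabs_def2 in hM. apply Rabs_def2 in hK. lra.
Qed.

(** * Partial fractions of the truncated products *)

Definition cpol q n u := fst (cspol q n u).
Definition spol q n u := snd (cspol q n u).

Lemma polar_cpol q n x : rho_n q n x * cos (theta_n q n x) = cpol q n (x ^ 2).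
Proof. apply polar_cspol. Qed.

Lemma polar_spol q n x : rho_n q n x * sin (theta_n q n x) = x * spol q n (x ^ 2).
Proof. apply polar_cspol. Qed.

Lemma cspol_at_0 q n : 0 < q < 1 -> cpol q n 0 = 1 /\ spol q n 0 = 1 - q ^ S n.
Proof.
  intros hq. rewrite <- sum_cq by easy. unfold cpol, spol.
  induction n as [|n [IH1 IH2]].
  - rewrite sum_O. easy.
  - rewrite sum_Sn. change plus with Rplus. cbn [cspol fst snd]. rewrite IH1, IH2.
    split; real_eq; ring.
Qed.

(** In the recursion only the c-part receives a factor u, so the degrees grow alternately. At even
    indices both bounds agree, which suits the quotients over s_n after one subtraction at 0; at odd
    indices s_n has the smaller bound, so the quotients over c_n are proper. *)
Lemma cspol_degree q M :
  poly_lt (S M) (cpol q (2 * M)) /\ poly_lt (S M) (spol q (2 * M)) /\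
  poly_lt (S (S M)) (cpol q (S (2 * M))) /\ poly_lt (S M) (spol q (S (2 * M))).
Proof.
  assert (step : forall n a b, poly_lt (S a) (cpol q n) -> poly_lt a (spol q n) ->
            poly_lt b (cpol q n) -> poly_lt b (spol q n) ->
            poly_lt (S a) (cpol q (S n)) /\ poly_lt b (spol q (S n))).
  { intros n a b h1 h2 h3 h4. split.
    - apply poly_lt_ext with (fun u => 1 * cpol q n u + - cq q (S n) * (u * spol q n u)).
      + intros u. unfold cpol, spol. cbn [cspol fst snd]. ring.
      + apply poly_lt_lincomb; [easy | now apply poly_lt_mul_x].
    - apply poly_lt_ext with (fun u => 1 * spol q n u + cq q (S n) * cpol q n u).
      + intros u. unfold cpol, spol. cbn [cspol fst snd]. ring.
      + now apply poly_lt_lincomb. }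
  induction M as [|M (h1 & h2 & h3 & h4)].
  - assert (h1 : poly_lt 1 (cpol q 0)) by apply poly_lt_one.
    assert (h2 : poly_lt 1 (spol q 0)).
    { exists (cq q 0), (fun _ => 0). split; [easy|]. intros u. unfold spol; simpl; ring. }
    split; [easy|]. split; [easy|]. apply step; try easy. now apply poly_lt_S.
  - replace (2 * S M)%nat with (S (S (2 * M))) by lia.
    destruct (step (S (2 * M)) (S M) (S (S M))) as [h5 h6]; try easy.
    { now apply poly_lt_S. }
    split; [easy|]. split; [easy|]. apply step; try easy. now apply poly_lt_S.
Qed.

Lemma cspol_ex_derive q n u : ex_derive (cpol q n) u /\ ex_derive (spol q n) u.
Proof.
  destruct (Nat.Even_or_Odd n) as [[M ->]|[M ->]];
    destruct (cspol_degree q M) as (h1 & h2 & h3 & h4); rewrite ?Nat.add_1_r;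
    split; eapply poly_lt_ex_derive; eassumption.
Qed.

(** The derivative in u = x^2 is read off by differentiating y s_n(y^2) = rho_n sin theta_n in y on
    both sides. *)
Lemma spol_at_root q n x : 0 < q < 1 -> 0 < x -> sin (theta_n q n x) = 0 ->
  spol q n (x ^ 2) = 0 /\
  Derive (spol q n) (x ^ 2)
  = rho_n q n x * gsum datf q n x * cos (theta_n q n x) / (2 * x ^ 2).
Proof.
  intros hq hx h0.
  assert (e0 : spol q n (x ^ 2) = 0).
  { assert (h := polar_spol q n x). rewrite h0, Rmult_0_r in h.
    symmetry in h. apply Rmult_integral in h. lra. }
  split; [easy|].
  assert (hex := Derive_correct _ _ (proj2 (cspol_ex_derive q n (x ^ 2)))).
  assert (h1 : is_derive (fun y => y * spol q n (y ^ 2)) x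
                 (2 * x ^ 2 * Derive (spol q n) (x ^ 2))).
  { evar_last.
    - apply (is_derive_mult (fun y => y) (fun y => spol q n (y ^ 2)) x).
      + apply is_derive_id.
      + apply (is_derive_comp (spol q n) (fun y => y ^ 2)); [exact hex|].
        apply is_derive_pow. apply is_derive_id.
      + intros; apply Rmult_comm.
    - unfold plus, mult, scal; simpl; unfold mult, one; simpl.
      simpl in e0. rewrite e0. ring. }
  assert (h2 : is_derive (fun y => y * spol q n (y ^ 2)) x
                 (rho_n q n x * gsum datf q n x * cos (theta_n q n x))).
  { apply is_derive_ext with (fun y => rho_n q n y * sin (theta_n q n y));
      [intros; apply polar_spol|].
    evar_last.
    - apply (is_derive_mult (rho_n q n) (fun y => sin (theta_n q n y)) x).
      + now apply is_derive_rho_n.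
      + apply (is_derive_comp sin); [apply is_derive_sin | now apply is_derive_theta_n].
      + intros; apply Rmult_comm.
    - unfold plus, mult, scal; simpl; unfold mult; simpl. rewrite h0. ring. }
  apply is_derive_unique in h1. apply is_derive_unique in h2. rewrite h1 in h2.
  rewrite <- h2. field. lra.
Qed.

Lemma cpol_at_root q n x : 0 < q < 1 -> 0 < x -> cos (theta_n q n x) = 0 ->
  cpol q n (x ^ 2) = 0 /\
  Derive (cpol q n) (x ^ 2)
  = - (rho_n q n x * gsum datf q n x * sin (theta_n q n x)) / (2 * x).
Proof.
  intros hq hx h0. split.
  { rewrite <- polar_cpol, h0. ring. }
  assert (hex := Derive_correct _ _ (proj1 (cspol_ex_derive q n (x ^ 2)))).
  assert (h1 : is_derive (fun y => cpol q n (y ^ 2)) x (2 * x * Derive (cpol q n) (x ^ 2))).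
  { evar_last.
    - apply (is_derive_comp (cpol q n) (fun y => y ^ 2)); [exact hex|].
      apply is_derive_pow. apply is_derive_id.
    - unfold scal; simpl; unfold mult, one; simpl. ring. }
  assert (h2 : is_derive (fun y => cpol q n (y ^ 2)) x
                 (- (rho_n q n x * gsum datf q n x * sin (theta_n q n x)))).
  { apply is_derive_ext with (fun y => rho_n q n y * cos (theta_n q n y));
      [intros; apply polar_cpol|].
    evar_last.
    - apply (is_derive_mult (rho_n q n) (fun y => cos (theta_n q n y)) x).
      + now apply is_derive_rho_n.
      + apply (is_derive_comp cos); [apply is_derive_cos | now apply is_derive_theta_n].
      + intros; apply Rmult_comm.
    - unfold plus, mult, scal; simpl; unfold mult; simpl. rewrite h0. ring. }
  apply is_derive_unique in h1. apply is_derive_unique in h2. rewrite h1 in h2.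
  rewrite <- h2. field. lra.
Qed.

Lemma roots_exist q (nn : nat -> nat) (t : nat -> R) : 0 < q < 1 ->
  (forall m k, (k <= m)%nat -> 0 < t k < INR (S (nn m)) * (PI / 2)) ->
  {r : nat -> nat -> R |
    forall m k, (k <= m)%nat -> 0 < r m k /\ theta_n q (nn m) (r m k) = t k}.
Proof.
  intros hq ht.
  exists (fun m k => match Compare_dec.le_dec k m with
             | left h => proj1_sig (theta_n_root q (nn m) (t k) hq (ht m k h))
             | right _ => 0
             end).
  intros m k hk. destruct (Compare_dec.le_dec k m) as [h|h]; [|lia].
  exact (proj2_sig (theta_n_root q (nn m) (t k) hq (ht m k h))).
Qed.

Lemma inv_sq_diff_bound x r : 0 < x < / 2 -> 1 <= r ->
  Rabs (/ (x ^ 2 - r ^ 2)) <= 2 / r ^ 2.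
Proof.
  intros hx hr. assert (h1 : x ^ 2 <= / 4) by nra. assert (h2 : 1 <= r ^ 2) by nra.
  rewrite Rabs_inv, Rabs_left by lra.
  replace (2 / r ^ 2) with (/ (r ^ 2 / 2)) by (field; lra).
  apply Rinv_le_contravar; lra.
Qed.

(** The r^2 in [weight_bound] cancels against the r^(-2) of the pole factor, leaving the summable
    q^k. *)
Lemma term_bound q k a A0 d x r : 0 < q < 1 -> 0 < x < / 2 -> 0 <= r -> 1 <= q ^ k * r ->
  datf (cq q k) r <= d -> Rabs a <= A0 ->
  Rabs (a / d / (x ^ 2 - r ^ 2)) <= 2 * A0 * wbound q * q ^ k.
Proof.
  intros hq hx hr0 hr hd ha.
  assert (hr1 : 1 <= r). { assert (h := pow_le_1 q k hq). nra. }
  assert (hdp : 0 < d) by (eapply Rlt_le_trans; [apply datf_pos, (cq_pos q k hq) | apply hd]).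
  assert (h1 := weight_bound q k r d hq hr hd).
  assert (h2 := inv_sq_diff_bound x r hx hr1).
  unfold Rdiv. rewrite !Rabs_mult, (Rabs_pos_eq (/ d)) by (left; now apply Rinv_0_lt_compat).
  assert (hr2 : 0 < r ^ 2) by nra.
  replace (2 * A0 * wbound q * q ^ k)
    with (A0 * (wbound q * q ^ k * r ^ 2) * (2 / r ^ 2)) by (field; nra).
  apply Rmult_le_compat; [|apply Rabs_pos| |exact h2].
  - apply Rmult_le_pos; [apply Rabs_pos | left; now apply Rinv_0_lt_compat].
  - apply Rmult_le_compat; [apply Rabs_pos | left; now apply Rinv_0_lt_compat | easy | easy].
Qed.

Lemma filterlim_ge_id (nn : nat -> nat) :
  (forall m, (m <= nn m)%nat) -> filterlim nn eventually eventually.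
Proof.
  intros H P [N HN]. exists N. intros m hm. apply HN. specialize (H m). lia.
Qed.

Lemma partial_fractions_limit q (nn : nat -> nat) (t xi : nat -> R) (r : nat -> nat -> R)
    (A : nat -> nat -> R) (a : nat -> R) (A0 x : R) :
  0 < q < 1 -> (forall m, (m <= nn m)%nat) ->
  (forall k, (INR k + / 2) * PI <= t k) ->
  (forall m k, (k <= m)%nat -> 0 < r m k /\ theta_n q (nn m) (r m k) = t k) ->
  (forall k, 0 < xi k /\ theta q (xi k) = t k) ->
  (forall m k, (k <= m)%nat -> Rabs (A m k) <= A0) ->
  (forall k, is_lim_seq (fun m => r m k) (xi k) -> is_lim_seq (fun m => A m k) (a k)) ->
  0 < x < / 2 ->
  is_lim_seq
    (fun m => sum_n (fun k => A m k / gsum datf q (nn m) (r m k) / (x ^ 2 - (r m k) ^ 2)) m)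
    (Series (fun k => a k / gser datf q (xi k) / (x ^ 2 - (xi k) ^ 2))).
Proof.
  intros hq hnn ht hr hxi hA hAl hx.
  assert (hA0 : 0 <= A0) by (eapply Rle_trans; [apply Rabs_pos | apply (hA O O); lia]).
  assert (hfl := filterlim_ge_id nn hnn).
  assert (hconv : forall k, is_lim_seq (fun m => r m k) (xi k)).
  { intros k. destruct (hxi k) as [h1 h2].
    apply (roots_converge q nn _ (xi k) (t k)); try easy.
    exists k. intros m hm. now apply hr. }
  apply (tannery _ _ (2 * A0 * wbound q) q hq).
  - assert (0 < wbound q).
    { unfold wbound. assert (0 < / (1 - q)) by (apply Rinv_0_lt_compat; lra). lra. }
    apply Rmult_le_pos; lra.
  - intros m k hk. destruct (hr m k hk) as [h1 h2].
    apply term_bound; try easy.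
    + lra.
    + apply (root_lower q (nn m) k _ (t k)); try easy; [lra|]. specialize (hnn m); lia.
    + apply dtheta_n_ge; [easy|]. specialize (hnn m); lia.
    + now apply hA.
  - intros k. destruct (hxi k) as [h1 h2].
    assert (hx1 : 1 <= q ^ k * xi k)
      by (apply (root_lower_limit q k _ (t k)); try easy; lra).
    assert (hx2 : 1 <= xi k) by (assert (h := pow_le_1 q k hq); nra).
    apply is_lim_seq_div'.
    + apply is_lim_seq_div'; [now apply hAl| |].
      * apply gsum_lim_moving; try easy. apply datf_lipschitz.
      * assert (h := dtheta_pos q (xi k) hq). lra.
    + apply is_lim_seq_minus'; [apply is_lim_seq_const|].
      simpl. apply is_lim_seq_mult'; [easy|]. apply is_lim_seq_mult'; [easy|].
      apply is_lim_seq_const.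
    + nra.
Qed.

(** * Expansions of the q-trigonometric quotients *)

Lemma theta_small q x : 0 < q < 1 -> 0 < x < / 2 -> 0 < theta q x < PI / 2.
Proof.
  intros hq hx. assert (h := theta_increasing q 0 x hq ltac:(lra)). rewrite theta_0 in h.
  assert (h1 := theta_le_self q x hq ltac:(lra)). assert (hP := PI2_1). lra.
Qed.

Lemma theta_n_small q n x : 0 < q < 1 -> 0 < x < / 2 -> 0 < theta_n q n x < PI / 2.
Proof.
  intros hq hx. assert (h := theta_n_increasing q n 0 x hq ltac:(lra)). rewrite theta_n_0 in h.
  assert (h1 := theta_n_le_self q n x hq ltac:(lra)). assert (hP := PI2_1). lra.
Qed.

Lemma rho_pos q x : 0 < rho q x.
Proof. apply exp_pos. Qed.

Lemma rho_n_pos q n x : 0 < rho_n q n x.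
Proof. apply exp_pos. Qed.

Lemma roots_distinct q n (r t : nat -> R) m :
  (forall k, (k <= m)%nat -> 0 < r k /\ theta_n q n (r k) = t k) ->
  (forall i j, i <> j -> t i <> t j) ->
  forall i j, (i <= m)%nat -> (j <= m)%nat -> i <> j -> (r i) ^ 2 <> (r j) ^ 2.
Proof.
  intros hr ht i j hi hj hne e. apply (ht i j hne).
  destruct (hr i hi) as [h1 <-]. destruct (hr j hj) as [h2 <-].
  f_equal. nra.
Qed.

(** Common to the expansions of Cot_q and 1 / Sin_q: the numerator p_m is c_n or 1, both with value
    1 at 0. At truncation n = 2m + 2 the m + 1 squared roots exhaust the degree bound of s_n. *)
Lemma sin_expansion q (t xi : nat -> R) (r : nat -> nat -> R)
    (p : nat -> R -> R) (a : nat -> R) (P x : R) :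
  0 < q < 1 -> (forall k, (INR k + / 2) * PI <= t k) -> (forall k, sin (t k) = 0) ->
  (forall i j, i <> j -> t i <> t j) ->
  (forall m k, (k <= m)%nat -> 0 < r m k /\ theta_n q (2 * S m) (r m k) = t k) ->
  (forall k, 0 < xi k /\ theta q (xi k) = t k) ->
  (forall m, poly_lt (S (S m)) (p m)) -> (forall m, p m 0 = 1) ->
  is_lim_seq (fun m => p m (x ^ 2)) P ->
  (forall m k, (k <= m)%nat ->
     Rabs (2 * p m ((r m k) ^ 2) / (rho_n q (2 * S m) (r m k) * cos (t k))) <= 2) ->
  (forall k, is_lim_seq (fun m => r m k) (xi k) ->
     is_lim_seq (fun m => 2 * p m ((r m k) ^ 2) / (rho_n q (2 * S m) (r m k) * cos (t k)))
       (a k)) ->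
  0 < x < / 2 ->
  P * x / (rho q x * sin (theta q x)) =
  1 + x ^ 2 * Series (fun k => a k / gser datf q (xi k) / (x ^ 2 - (xi k) ^ 2)).
Proof.
  intros hq ht hsin hdist hr hxi hp hp0 hP hA hAl hx.
  set (nn := fun m => (2 * S m)%nat).
  assert (hnn : forall m, (m <= nn m)%nat) by (intros m; unfold nn; lia).
  assert (hfl := filterlim_ge_id nn hnn).
  assert (hsx : 0 < sin (theta q x)) by (apply sin_gt_0; assert (h := theta_small q x hq hx); lra).
  assert (hL := partial_fractions_limit q nn t xi r _ a 2 x hq hnn ht hr hxi hA hAl hx).
  assert (h1 : is_lim_seq (fun m => p m (x ^ 2) * x / (rho_n q (nn m) x * sin (theta_n q (nn m) x)))
                 (P * x / (rho q x * sin (theta q x)))).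
  { apply is_lim_seq_div'.
    - apply is_lim_seq_mult'; [easy | apply is_lim_seq_const].
    - apply is_lim_seq_mult'.
      + apply rho_n_lim_moving; try easy. apply is_lim_seq_const.
      + apply is_lim_seq_sin. apply theta_n_lim_moving; try easy. apply is_lim_seq_const.
    - assert (h := rho_pos q x). nra. }
  (* The constant term p(0) / s_n(0), since s_n(0) is the sum of the c_j up to n. *)
  assert (h2 : is_lim_seq (fun m => / (1 - q ^ S (nn m))) (/ (1 - 0))).
  { apply (is_lim_seq_inv _ (Finite (1 - 0))); [|intros h; injection h; lra].
    apply is_lim_seq_minus'; [apply is_lim_seq_const|].
    apply (is_lim_seq_subseq (fun n => q ^ n) 0 (fun m => S (nn m))).
    - apply filterlim_ge_id. intros m; unfold nn; lia.
    - apply is_lim_seq_geom. rewrite Rabs_pos_eq; lra. }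
  replace (/ (1 - 0)) with 1 in h2 by field.
  assert (h3 := is_lim_seq_plus' _ _ _ _ h2
                  (is_lim_seq_mult' _ _ _ _ (is_lim_seq_const (x ^ 2)) hL)).
  apply is_lim_seq_unique in h1.
  apply is_lim_seq_ext with (v := fun m => p m (x ^ 2) * x / (rho_n q (nn m) x * sin (theta_n q (nn m) x))) in h3.
  { apply is_lim_seq_unique in h3. rewrite h1 in h3. now injection h3. }
  intros m.
  assert (hsm : 0 < sin (theta_n q (nn m) x))
    by (apply sin_gt_0; assert (h := theta_n_small q (nn m) x hq hx); lra).
  assert (hrm := rho_n_pos q (nn m) x).
  assert (hroot : forall k, (k <= m)%nat ->
            spol q (nn m) ((r m k) ^ 2) = 0 /\
            Derive (spol q (nn m)) ((r m k) ^ 2)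
            = rho_n q (nn m) (r m k) * gsum datf q (nn m) (r m k) * cos (t k)
              / (2 * (r m k) ^ 2)).
  { intros k hk. destruct (hr m k hk) as [e1 e2]. fold (nn m) in e2.
    rewrite <- e2. apply spol_at_root; [easy|easy|]. rewrite e2; apply hsin. }
  assert (hcos : forall k, cos (t k) <> 0).
  { intros k h. assert (h' := sin2_cos2 (t k)). rewrite (hsin k), h in h'.
    unfold Rsqr in h'. lra. }
  rewrite polar_spol.
  assert (hsv : x * spol q (nn m) (x ^ 2) <> 0) by (rewrite <- polar_spol; nra).
  assert (hsv' : spol q (nn m) (x ^ 2) <> 0) by (intros h; apply hsv; rewrite h; ring).
  replace (p m (x ^ 2) * x / (x * spol q (nn m) (x ^ 2)))
    with (p m (x ^ 2) / spol q (nn m) (x ^ 2)) by (field; split; [easy|lra]).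
  rewrite (partial_fractions m (p m) (spol q (nn m)) (fun k => (r m k) ^ 2)).
  - destruct (cspol_at_0 q (nn m) hq) as [_ e]. rewrite e, hp0.
    unfold Rdiv at 4. rewrite Rmult_1_l. f_equal. f_equal.
    apply sum_n_ext_loc. intros k hk. destruct (hroot k hk) as [_ ->].
    destruct (hr m k hk) as [e1 e2].
    assert (hd := dtheta_n_pos q (nn m) (r m k) hq).
    assert (hrk := rho_n_pos q (nn m) (r m k)).
    (* The root is at least 1 while x < 1/2, so x^2 - r^2 is nonzero for [field]. *)
    assert (hlow := root_lower q (nn m) k (r m k) (t k) hq ltac:(lra) ltac:(unfold nn; lia) e2 (ht k)).
    assert (hr1 : 1 <= r m k) by (assert (h := pow_le_1 q k hq); nra).
    specialize (hcos k). fold (nn m). real_eq. field.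
    repeat split; try lra; try easy; try nra.
  - apply hp.
  - apply (cspol_degree q (S m)).
  - destruct (cspol_at_0 q (nn m) hq) as [_ e]. rewrite e.
    assert (h := pow_le_1 q (nn m) hq). assert (0 < q ^ nn m) by (apply pow_lt; lra).
    change (q ^ S (nn m)) with (q * q ^ nn m). nra.
  - apply (roots_distinct q (nn m) (r m) t); [intros; now apply hr | easy].
  - intros k hk. destruct (hroot k hk) as [e ->]. split; [easy|].
    destruct (hr m k hk) as [e1 e2].
    assert (hd := dtheta_n_pos q (nn m) (r m k) hq).
    assert (hrk := rho_n_pos q (nn m) (r m k)).
    specialize (hcos k). unfold Rdiv.
    repeat apply Rmult_integral_contrapositive_currified; try lra; try easy.
    apply Rinv_neq_0_compat. nra.
  - easy.
Qed.

(** Common to Tan_q and 1 / Cos_q, with numerator s_n or 1. At n = 2m + 1 the numerator has degree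
    at most m against m + 1 roots of c_n, so no subtraction at 0 is made. *)
Lemma cos_expansion q (t xi : nat -> R) (r : nat -> nat -> R)
    (p : nat -> R -> R) (a : nat -> R) (A0 P x : R) :
  0 < q < 1 -> (forall k, (INR k + / 2) * PI <= t k) -> (forall k, cos (t k) = 0) ->
  (forall i j, i <> j -> t i <> t j) ->
  (forall m k, (k <= m)%nat -> 0 < r m k /\ theta_n q (S (2 * m)) (r m k) = t k) ->
  (forall k, 0 < xi k /\ theta q (xi k) = t k) ->
  (forall m, poly_lt (S m) (p m)) ->
  is_lim_seq (fun m => p m (x ^ 2)) P ->
  (forall m k, (k <= m)%nat ->
     Rabs (- (2 * r m k * p m ((r m k) ^ 2)) / (rho_n q (S (2 * m)) (r m k) * sin (t k))) <= A0) ->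
  (forall k, is_lim_seq (fun m => r m k) (xi k) ->
     is_lim_seq (fun m => - (2 * r m k * p m ((r m k) ^ 2))
                          / (rho_n q (S (2 * m)) (r m k) * sin (t k)))
       (a k)) ->
  0 < x < / 2 ->
  P / (rho q x * cos (theta q x)) =
  Series (fun k => a k / gser datf q (xi k) / (x ^ 2 - (xi k) ^ 2)).
Proof.
  intros hq ht hcos hdist hr hxi hp hP hA hAl hx.
  set (nn := fun m => S (2 * m)).
  assert (hnn : forall m, (m <= nn m)%nat) by (intros m; unfold nn; lia).
  assert (hfl := filterlim_ge_id nn hnn).
  assert (hcx : 0 < cos (theta q x)) by (apply cos_gt_0; assert (h := theta_small q x hq hx); lra).
  assert (hL := partial_fractions_limit q nn t xi r _ a A0 x hq hnn ht hr hxi hA hAl hx).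
  assert (h1 : is_lim_seq (fun m => p m (x ^ 2) / (rho_n q (nn m) x * cos (theta_n q (nn m) x)))
                 (P / (rho q x * cos (theta q x)))).
  { apply is_lim_seq_div'.
    - easy.
    - apply is_lim_seq_mult'.
      + apply rho_n_lim_moving; try easy. apply is_lim_seq_const.
      + apply is_lim_seq_cos. apply theta_n_lim_moving; try easy. apply is_lim_seq_const.
    - assert (h := rho_pos q x). nra. }
  apply is_lim_seq_unique in h1.
  apply is_lim_seq_ext with (v := fun m => p m (x ^ 2) / (rho_n q (nn m) x * cos (theta_n q (nn m) x))) in hL.
  { apply is_lim_seq_unique in hL. rewrite h1 in hL. now injection hL. }
  intros m.
  assert (hcm : 0 < cos (theta_n q (nn m) x))
    by (apply cos_gt_0; assert (h := theta_n_small q (nn m) x hq hx); lra).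
  assert (hrm := rho_n_pos q (nn m) x).
  assert (hroot : forall k, (k <= m)%nat ->
            cpol q (nn m) ((r m k) ^ 2) = 0 /\
            Derive (cpol q (nn m)) ((r m k) ^ 2)
            = - (rho_n q (nn m) (r m k) * gsum datf q (nn m) (r m k) * sin (t k))
              / (2 * r m k)).
  { intros k hk. destruct (hr m k hk) as [e1 e2]. fold (nn m) in e2.
    rewrite <- e2. apply cpol_at_root; [easy|easy|]. rewrite e2; apply hcos. }
  assert (hsin : forall k, sin (t k) <> 0).
  { intros k h. assert (h' := sin2_cos2 (t k)). rewrite (hcos k), h in h'.
    unfold Rsqr in h'. lra. }
  rewrite polar_cpol.
  assert (hcv : cpol q (nn m) (x ^ 2) <> 0) by (rewrite <- polar_cpol; nra).
  rewrite (partial_fractions_proper m (p m) (cpol q (nn m)) (fun k => (r m k) ^ 2)).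
  - apply sum_n_ext_loc. intros k hk. destruct (hroot k hk) as [_ ->].
    destruct (hr m k hk) as [e1 e2].
    assert (hd := dtheta_n_pos q (nn m) (r m k) hq).
    assert (hrk := rho_n_pos q (nn m) (r m k)).
    assert (hlow := root_lower q (nn m) k (r m k) (t k) hq ltac:(lra) ltac:(unfold nn; lia) e2 (ht k)).
    assert (hr1 : 1 <= r m k) by (assert (h := pow_le_1 q k hq); nra).
    specialize (hsin k). fold (nn m). real_eq. field.
    repeat split; try lra; try easy; try nra.
  - apply hp.
  - apply (cspol_degree q m).
  - apply (roots_distinct q (nn m) (r m) t); [intros; now apply hr | easy].
  - intros k hk. destruct (hroot k hk) as [e ->]. split; [easy|].
    destruct (hr m k hk) as [e1 e2].
    assert (hd := dtheta_n_pos q (nn m) (r m k) hq).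
    assert (hrk := rho_n_pos q (nn m) (r m k)).
    specialize (hsin k). unfold Rdiv.
    apply Rmult_integral_contrapositive_currified.
    + apply Ropp_neq_0_compat.
      repeat apply Rmult_integral_contrapositive_currified; try lra; try easy.
    + apply Rinv_neq_0_compat. nra.
  - easy.
Qed.

(** The phase 0 belongs to x = 0, which is not a positive zero; hence the shift by one. *)
Definition sin_phase (k : nat) : R := (INR k + 1) * PI.
Definition cos_phase (k : nat) : R := (INR k + / 2) * PI.

Lemma sin_cos_INR_PI k : sin (INR k * PI) = 0 /\ cos (INR k * PI) = (-1) ^ k.
Proof.
  induction k as [|k [IH1 IH2]].
  - simpl INR. rewrite Rmult_0_l, sin_0, cos_0. split; simpl; ring.
  - rewrite S_INR. replace ((INR k + 1) * PI) with (INR k * PI + PI) by ring.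
    rewrite neg_sin, neg_cos, IH1, IH2. simpl. split; ring.
Qed.

Lemma sin_phase_values k : sin (sin_phase k) = 0 /\ cos (sin_phase k) = (-1) ^ S k.
Proof. unfold sin_phase. rewrite <- S_INR. apply sin_cos_INR_PI. Qed.

Lemma cos_phase_values k : cos (cos_phase k) = 0 /\ sin (cos_phase k) = (-1) ^ k.
Proof.
  unfold cos_phase. replace ((INR k + / 2) * PI) with (INR k * PI + PI / 2) by field.
  destruct (sin_cos_INR_PI k) as [h1 h2].
  rewrite cos_plus, sin_plus, cos_PI2, sin_PI2, h1, h2. split; ring.
Qed.

Lemma sin_phase_inj i j : i <> j -> sin_phase i <> sin_phase j.
Proof.
  intros hne e. apply hne. unfold sin_phase in e. assert (hP := PI_RGT_0).
  apply Rmult_eq_reg_r in e; [|lra]. apply INR_eq. lra.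
Qed.

Lemma cos_phase_inj i j : i <> j -> cos_phase i <> cos_phase j.
Proof.
  intros hne e. apply hne. unfold cos_phase in e. assert (hP := PI_RGT_0).
  apply Rmult_eq_reg_r in e; [|lra]. apply INR_eq. lra.
Qed.

Lemma pow_m1_neq_0 k : (-1) ^ k <> 0.
Proof. apply pow_nonzero. lra. Qed.

Lemma sin_roots q : 0 < q < 1 ->
  {r : nat -> nat -> R |
    forall m k, (k <= m)%nat -> 0 < r m k /\ theta_n q (2 * S m) (r m k) = sin_phase k}.
Proof.
  intros hq. apply (roots_exist q (fun m => (2 * S m)%nat) sin_phase hq).
  (* With 2m + 3 factors the phase tends to (m + 3/2) pi, above the largest value (m + 1) pi in
     question. *)
  intros m k hk. assert (hP := PI_RGT_0). apply le_INR in hk. assert (h := pos_INR k).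
  replace (S (2 * S m)) with (2 * m + 3)%nat by lia. rewrite plus_INR, mult_INR. simpl INR.
  unfold sin_phase. split; nra.
Qed.

Lemma cos_roots q : 0 < q < 1 ->
  {r : nat -> nat -> R |
    forall m k, (k <= m)%nat -> 0 < r m k /\ theta_n q (S (2 * m)) (r m k) = cos_phase k}.
Proof.
  intros hq. apply (roots_exist q (fun m => (S (2 * m))%nat) cos_phase hq).
  intros m k hk. assert (hP := PI_RGT_0). apply le_INR in hk. assert (h := pos_INR k).
  replace (S (S (2 * m))) with (2 * m + 2)%nat by lia. rewrite plus_INR, mult_INR. simpl INR.
  unfold cos_phase. split; nra.
Qed.

Lemma cot_expansion q (xi : nat -> R) x : 0 < q < 1 ->
  (forall k, 0 < xi k /\ theta q (xi k) = sin_phase k) -> 0 < x < / 2 ->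
  x * cos (theta q x) / sin (theta q x) =
  1 + x ^ 2 * Series (fun k => 2 / gser datf q (xi k) / (x ^ 2 - (xi k) ^ 2)).
Proof.
  intros hq hxi hx. destruct (sin_roots q hq) as [r hr].
  assert (hfl : filterlim (fun m => (2 * S m)%nat) eventually eventually)
    by (apply filterlim_ge_id; lia).
  (* At a root r one has c_n(r^2) = rho_n cos theta_n exactly, so the residue numerator does not
     depend on m. *)
  assert (eA : forall m k, (k <= m)%nat ->
    2 * cpol q (2 * S m) ((r m k) ^ 2) / (rho_n q (2 * S m) (r m k) * cos (sin_phase k)) = 2).
  { intros m k hk. destruct (hr m k hk) as [h1 h2].
    rewrite <- polar_cpol, h2, (proj2 (sin_phase_values k)).
    assert (h := rho_n_pos q (2 * S m) (r m k)). assert (h' := pow_m1_neq_0 (S k)).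
    field. split; [easy|lra]. }
  rewrite <- (sin_expansion q sin_phase xi r (fun m => cpol q (2 * S m)) (fun _ => 2)
    (rho q x * cos (theta q x)) x hq); try easy.
  - assert (h := rho_pos q x).
    assert (hsx : 0 < sin (theta q x)) by (apply sin_gt_0; assert (h' := theta_small q x hq hx); lra).
    field. lra.
  - intros k. unfold sin_phase. assert (hP := PI_RGT_0). apply Rmult_le_compat_r; lra.
  - intros; apply sin_phase_values.
  - intros; now apply sin_phase_inj.
  - intros m. apply (cspol_degree q (S m)).
  - intros m. now apply cspol_at_0.
  - apply is_lim_seq_ext with (fun m => rho_n q (2 * S m) x * cos (theta_n q (2 * S m) x)).
    { intros; apply polar_cpol. }
    apply is_lim_seq_mult'; [|apply is_lim_seq_cos].
    + apply (rho_n_lim_moving q (fun _ => x) _ x hq hfl (is_lim_seq_const _)).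
    + apply (theta_n_lim_moving q (fun _ => x) _ x hq hfl (is_lim_seq_const _)).
  - intros m k hk. rewrite eA by easy. rewrite Rabs_pos_eq; lra.
  - intros k _. apply is_lim_seq_ext_loc with (fun _ => 2); [|apply is_lim_seq_const].
    exists k. intros m hm. now rewrite eA.
Qed.

Lemma csc_expansion q (xi : nat -> R) x : 0 < q < 1 ->
  (forall k, 0 < xi k /\ theta q (xi k) = sin_phase k) -> 0 < x < / 2 ->
  x / (rho q x * sin (theta q x)) =
  1 + x ^ 2 * Series (fun k => 2 / (rho q (xi k) * (-1) ^ S k) / gser datf q (xi k)
                               / (x ^ 2 - (xi k) ^ 2)).
Proof.
  intros hq hxi hx. destruct (sin_roots q hq) as [r hr].
  assert (hfl : filterlim (fun m => (2 * S m)%nat) eventually eventually)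
    by (apply filterlim_ge_id; lia).
  rewrite <- (sin_expansion q sin_phase xi r (fun m _ => 1)
    (fun k => 2 / (rho q (xi k) * (-1) ^ S k)) 1 x hq); try easy.
  - now rewrite Rmult_1_l.
  - intros k. unfold sin_phase. assert (hP := PI_RGT_0). apply Rmult_le_compat_r; lra.
  - intros; apply sin_phase_values.
  - intros; now apply sin_phase_inj.
  - intros m. apply poly_lt_one.
  - apply is_lim_seq_const.
  - intros m k hk. rewrite (proj2 (sin_phase_values k)).
    destruct (rho_n_ge q (2 * S m) (r m k) hq) as [h _].
    unfold Rdiv. rewrite Rmult_1_r, Rabs_mult, Rabs_inv, Rabs_mult, pow_1_abs, Rmult_1_r.
    rewrite !Rabs_pos_eq by lra. apply Rle_div_l; lra.
  - intros k hk. rewrite (proj2 (sin_phase_values k)).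
    apply is_lim_seq_div'.
    + apply is_lim_seq_ext with (fun _ => 2); [intros; ring | apply is_lim_seq_const].
    + apply is_lim_seq_mult'; [|apply is_lim_seq_const].
      now apply rho_n_lim_moving.
    + assert (h := rho_pos q (xi k)). assert (h' := pow_m1_neq_0 (S k)).
      apply Rmult_integral_contrapositive_currified; [lra | easy].
Qed.

Lemma tan_expansion q (eta : nat -> R) x : 0 < q < 1 ->
  (forall k, 0 < eta k /\ theta q (eta k) = cos_phase k) -> 0 < x < / 2 ->
  sin (theta q x) / (x * cos (theta q x)) =
  Series (fun k => -2 / gser datf q (eta k) / (x ^ 2 - (eta k) ^ 2)).
Proof.
  intros hq hxi hx. destruct (cos_roots q hq) as [r hr].
  assert (hfl : filterlim (fun m => S (2 * m)) eventually eventually)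
    by (apply filterlim_ge_id; lia).
  assert (eA : forall m k, (k <= m)%nat ->
    - (2 * r m k * spol q (S (2 * m)) ((r m k) ^ 2))
    / (rho_n q (S (2 * m)) (r m k) * sin (cos_phase k)) = -2).
  { intros m k hk. destruct (hr m k hk) as [h1 h2].
    rewrite Rmult_assoc, <- polar_spol, h2, (proj2 (cos_phase_values k)).
    assert (h := rho_n_pos q (S (2 * m)) (r m k)). assert (h' := pow_m1_neq_0 k).
    field. split; [easy|lra]. }
  rewrite <- (cos_expansion q cos_phase eta r (fun m => spol q (S (2 * m))) (fun _ => -2) 2
    (rho q x * sin (theta q x) / x) x hq); try easy.
  - assert (h := rho_pos q x).
    assert (hcx : 0 < cos (theta q x)) by (apply cos_gt_0; assert (h' := theta_small q x hq hx); lra).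
    field. lra.
  - intros; apply cos_phase_values.
  - intros; now apply cos_phase_inj.
  - intros m. apply (cspol_degree q m).
  - apply is_lim_seq_ext with (fun m => rho_n q (S (2 * m)) x * sin (theta_n q (S (2 * m)) x) / x).
    { intros; rewrite polar_spol. field. lra. }
    apply is_lim_seq_mult'; [|apply is_lim_seq_const].
    apply is_lim_seq_mult'; [|apply is_lim_seq_sin].
    + apply (rho_n_lim_moving q (fun _ => x) _ x hq hfl (is_lim_seq_const _)).
    + apply (theta_n_lim_moving q (fun _ => x) _ x hq hfl (is_lim_seq_const _)).
  - intros m k hk. rewrite eA by easy. rewrite Rabs_left; lra.
  - intros k _. apply is_lim_seq_ext_loc with (fun _ => -2); [|apply is_lim_seq_const].
    exists k. intros m hm. now rewrite eA.
Qed.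

Lemma sec_expansion q (eta : nat -> R) x : 0 < q < 1 ->
  (forall k, 0 < eta k /\ theta q (eta k) = cos_phase k) -> 0 < x < / 2 ->
  1 / (rho q x * cos (theta q x)) =
  Series (fun k => - (2 * eta k) / (rho q (eta k) * (-1) ^ k) / gser datf q (eta k)
                   / (x ^ 2 - (eta k) ^ 2)).
Proof.
  intros hq hxi hx. destruct (cos_roots q hq) as [r hr].
  assert (hfl : filterlim (fun m => S (2 * m)) eventually eventually)
    by (apply filterlim_ge_id; lia).
  apply (cos_expansion q cos_phase eta r (fun m _ => 1)
    (fun k => - (2 * eta k) / (rho q (eta k) * (-1) ^ k)) (2 / cq q 0) 1 x hq); try easy.
  - intros; apply cos_phase_values.
  - intros; now apply cos_phase_inj.
  - intros m. apply poly_lt_one.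
  - apply is_lim_seq_const.
  - intros m k hk. rewrite (proj2 (cos_phase_values k)).
    destruct (hr m k hk) as [hr0 _].
    destruct (rho_n_ge q (S (2 * m)) (r m k) hq) as [h h1].
    assert (hc := cq_pos q 0 hq). rewrite Rabs_pos_eq in h1 by lra.
    unfold Rdiv. rewrite Rmult_1_r, Rabs_mult, Rabs_inv, Rabs_Ropp, (Rabs_mult (rho_n _ _ _)), pow_1_abs, Rmult_1_r.
    rewrite !Rabs_pos_eq by lra. apply Rle_div_l; [lra|].
    (* The numerator 2r is unbounded, but rho_n >= c_0 r; this is the origin of the constant 2 /
       c_0. *)
    apply Rle_trans with (2 * / cq q 0 * (cq q 0 * r m k)); [right; field; lra|].
    apply Rmult_le_compat_l; [|easy].
    assert (h2 : 0 < / cq q 0) by now apply Rinv_0_lt_compat. lra.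
  - intros k hk. rewrite (proj2 (cos_phase_values k)).
    apply is_lim_seq_div'.
    + apply is_lim_seq_ext with (fun m => - 2 * r m k); [intros; ring |].
      replace (- (2 * eta k)) with (- 2 * eta k) by ring.
      apply is_lim_seq_mult'; [apply is_lim_seq_const | easy].
    + apply is_lim_seq_mult'; [|apply is_lim_seq_const].
      now apply rho_n_lim_moving.
    + assert (h := rho_pos q (eta k)). assert (h' := pow_m1_neq_0 k).
      apply Rmult_integral_contrapositive_currified; [lra | easy].
Qed.

(** * Asymptotic expansions at 0 *)

(* f(x) = a_0 + a_1 x^2 + ... + a_(n-1) x^(2n-2) + O(x^(2n)) on (0, 1/2); the recursive
   form makes products and uniqueness immediate. *)
Fixpoint asym (n : nat) (f : R -> R) (a : nat -> R) : Prop :=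
  match n with
  | O => exists B, forall x, 0 < x < / 2 -> Rabs (f x) <= B
  | S m => exists g, asym m g (fun k => a (S k)) /\
                     forall x, 0 < x < / 2 -> f x = a O + x ^ 2 * g x
  end.

Lemma asym_ext n f g a b : (forall x, 0 < x < / 2 -> f x = g x) -> (forall k, a k = b k) ->
  asym n f a -> asym n g b.
Proof.
  revert f g a b; induction n as [|n IH]; cbn [asym]; intros f g a b hf ha.
  - intros [B HB]. exists B. intros x hx. rewrite <- hf by easy. now apply HB.
  - intros (h & hh & e). exists h. split.
    + now apply IH with h (fun k => a (S k)).
    + intros x hx. rewrite <- hf, <- ha by easy. now apply e.
Qed.

Lemma asym_bounded n f a : asym n f a -> exists B, forall x, 0 < x < / 2 -> Rabs (f x) <= B.
Proof.
  revert f a; induction n as [|n IH]; cbn [asym]; intros f a; [easy|].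
  intros (g & hg & e). destruct (IH _ _ hg) as [B HB].
  exists (Rabs (a O) + B). intros x hx. rewrite e by easy.
  eapply Rle_trans; [apply Rabs_triang|]. apply Rplus_le_compat_l.
  rewrite Rabs_mult, (Rabs_pos_eq (x ^ 2)) by nra.
  specialize (HB x hx). assert (h := Rabs_pos (g x)).
  assert (x ^ 2 <= 1) by nra. nra.
Qed.

Lemma asym_pred n f a : asym (S n) f a -> asym n f a.
Proof.
  revert f a; induction n as [|n IH]; intros f a h.
  - apply (asym_bounded _ _ _ h).
  - destruct h as (g & hg & e). exists g. split; [now apply IH|easy].
Qed.

Lemma asym_lincomb n c d f g a b : asym n f a -> asym n g b ->
  asym n (fun x => c * f x + d * g x) (fun k => c * a k + d * b k).
Proof.
  revert f g a b; induction n as [|n IH]; cbn [asym]; intros f g a b.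
  - intros [B HB] [B' HB']. exists (Rabs c * B + Rabs d * B'). intros x hx.
    eapply Rle_trans; [apply Rabs_triang|]. rewrite !Rabs_mult.
    apply Rplus_le_compat; apply Rmult_le_compat_l; try apply Rabs_pos; auto.
  - intros (f1 & hf & ef) (g1 & hg & eg).
    exists (fun x => c * f1 x + d * g1 x). split; [now apply IH|].
    intros x hx. rewrite ef, eg by easy. ring.
Qed.

Definition conv (a b : nat -> R) (n : nat) : R := sum_n (fun k => a k * b (n - k)%nat) n.

Lemma sum_n_split_first (a : nat -> R) n : sum_n a (S n) = a O + sum_n (fun k => a (S k)) n.
Proof.
  induction n as [|n IH].
  - rewrite sum_Sn, !sum_O. easy.
  - rewrite sum_Sn, IH, (sum_Sn _ n). change plus with Rplus. real_eq. ring.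
Qed.

(** From f = a_0 + x^2 f_1 and g = b_0 + x^2 g_1 one gets fg = a_0 b_0 + x^2 (a_0 g_1 + f_1 g). The
    product f_1 g is needed to one order less, hence [asym_pred] for g. *)
Lemma asym_mult n f g a b : asym n f a -> asym n g b ->
  asym n (fun x => f x * g x) (conv a b).
Proof.
  revert f g a b; induction n as [|n IH]; intros f g a b.
  - intros [B HB] [B' HB']. exists (B * B'). intros x hx. rewrite Rabs_mult.
    apply Rmult_le_compat; try apply Rabs_pos; auto.
  - intros (f1 & hf & ef) hg. assert (hg' := asym_pred _ _ _ hg).
    destruct hg as (g1 & hg & eg).
    exists (fun x => a O * g1 x + 1 * (f1 x * g x)). split.
    + apply asym_ext with (fun x => a O * g1 x + 1 * (f1 x * g x))
        (fun k => a O * b (S k) + 1 * conv (fun k => a (S k)) b k); [easy| |].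
      * intros k. unfold conv. rewrite sum_n_split_first, Nat.sub_0_r, Rmult_1_l. easy.
      * apply asym_lincomb; [easy | now apply IH].
    + intros x hx. unfold conv. rewrite sum_O. cbn [Nat.sub].
      rewrite ef, !eg by easy. ring.
Qed.

Lemma asym_zero n f a : (forall x, 0 < x < / 2 -> f x = 0) -> asym (S n) f a ->
  forall k, (k <= n)%nat -> a k = 0.
Proof.
  revert f a; induction n as [|n IH]; intros f a hf (g & hg & e) k hk.
  all: assert (h0 : a O = 0).
  1, 3: destruct (asym_bounded _ _ _ hg) as [B HB];
    destruct (Req_dec (a O) 0) as [|hne]; [easy|]; exfalso;
    assert (hB : 0 <= B) by (eapply Rle_trans; [apply Rabs_pos | apply (HB (/ 4)); lra]);
    assert (hp := Rabs_pos_lt _ hne);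
    assert (hall : forall x, 0 < x < / 2 -> Rabs (a O) <= B * x);
    [ intros x hx; specialize (e x hx); rewrite hf in e by easy;
      replace (a O) with (- (x ^ 2 * g x)) by lra;
      rewrite Rabs_Ropp, Rabs_mult, (Rabs_pos_eq (x ^ 2)) by nra;
      specialize (HB x hx); assert (h := Rabs_pos (g x));
      assert (x ^ 2 <= x) by nra;
      apply Rle_trans with (x * Rabs (g x)); [apply Rmult_le_compat_r; easy|];
      rewrite Rmult_comm; apply Rmult_le_compat_r; lra
    (* This y is below 1/2 and satisfies B y < |a_0|, against |a_0| <= B y. *)
    | set (y := Rabs (a O) / (4 * (B + Rabs (a O))));
      assert (hden : 0 < 4 * (B + Rabs (a O))) by lra;
      assert (hy : 0 < y) by (now apply Rdiv_lt_0_compat);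
      assert (hyd : y * (4 * (B + Rabs (a O))) = Rabs (a O)) by (unfold y; field; lra);
      assert (hy2 : y < / 2) by nra;
      specialize (hall y (conj hy hy2)); nra ].
  - now replace k with O by lia.
  - destruct k as [|k]; [easy|].
    apply (IH g (fun k => a (S k))); [|easy|lia].
    intros x hx. specialize (e x hx). rewrite hf, h0 in e by easy.
    apply Rmult_eq_reg_l with (x ^ 2); [lra|]. nra.
Qed.

Lemma asym_unique n f a b : asym (S n) f a -> asym (S n) f b -> a n = b n.
Proof.
  intros ha hb.
  assert (h := asym_lincomb _ 1 (-1) _ _ _ _ ha hb).
  assert (h' := asym_zero _ _ _ (fun x _ => eq_ind_r (fun z => z = 0) (eq_refl 0)
    (ltac:(ring) : 1 * f x + -1 * f x = 0)) h n (le_n n)).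
  simpl in h'. lra.
Qed.

Definition even_series (c : nat -> R) (x : R) : R := Series (fun k => c k * (x ^ 2) ^ k).

Lemma even_term_bound c x k : (forall k, Rabs (c k) <= 1) -> 0 <= x <= / 2 ->
  Rabs (c k * (x ^ 2) ^ k) <= 1 * (/ 4) ^ k.
Proof.
  intros hc hx. rewrite Rabs_mult. apply Rmult_le_compat; try apply Rabs_pos; [easy|].
  rewrite Rabs_pos_eq by (apply pow_le; nra). apply pow_incr. nra.
Qed.

Lemma even_series_ex c x : (forall k, Rabs (c k) <= 1) -> 0 <= x <= / 2 ->
  ex_series (fun k => c k * (x ^ 2) ^ k).
Proof.
  intros hc hx. apply ex_series_geometric_bound with 1 (/ 4); [lra|].
  intros k; now apply even_term_bound.
Qed.

Lemma even_series_bound c x : (forall k, Rabs (c k) <= 1) -> 0 <= x <= / 2 ->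
  Rabs (even_series c x) <= 2.
Proof.
  intros hc hx. eapply Rle_trans.
  - apply (Rabs_Series_geometric_bound _ 1 (/ 4)); [lra|]. intros k; now apply even_term_bound.
  - lra.
Qed.

Lemma even_series_shift c x : (forall k, Rabs (c k) <= 1) -> 0 <= x <= / 2 ->
  even_series c x = c O + x ^ 2 * even_series (fun k => c (S k)) x.
Proof.
  intros hc hx. unfold even_series. rewrite Series_incr_1 by now apply even_series_ex.
  rewrite <- Series_scal_l. f_equal; [simpl; ring|]. apply Series_ext. intros k.
  cbn [pow]. ring.
Qed.

Lemma even_series_asym n c : (forall k, Rabs (c k) <= 1) -> asym n (even_series c) c.
Proof.
  revert c; induction n as [|n IH]; intros c hc.
  - exists 2. intros x hx. apply even_series_bound; [easy|lra].
  - exists (even_series (fun k => c (S k))). split; [now apply IH|].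
    intros x hx. apply even_series_shift; [easy|lra].
Qed.

(** * The functions cos_q and sin_q and their identity with Cos_q and Sin_q *)

Lemma qnum_ge_1 q n : 0 < q < 1 -> 1 <= qnum q (S n).
Proof.
  intros hq. unfold qnum. apply Rle_div_r; [lra|].
  assert (h := pow_le_1 q n hq). simpl; nra.
Qed.

Lemma qfact_ge_1 q n : 0 < q < 1 -> 1 <= qfact q n.
Proof.
  intros hq. induction n as [|n IH]; [simpl; lra|].
  simpl qfact. assert (h := qnum_ge_1 q n hq). nra.
Qed.

Definition cos_coef (q : R) (k : nat) : R := (-1) ^ k / qfact q (2 * k).
Definition sin_coef (q : R) (k : nat) : R := (-1) ^ k / qfact q (2 * k + 1).

Lemma coef_bound q k n : 0 < q < 1 -> Rabs ((-1) ^ k / qfact q n) <= 1.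
Proof.
  intros hq. assert (h := qfact_ge_1 q n hq).
  unfold Rdiv. rewrite Rabs_mult, pow_1_abs, Rmult_1_l, Rabs_inv, Rabs_pos_eq by lra.
  rewrite <- Rinv_1. apply Rinv_le_contravar; lra.
Qed.

(* cos_q x and sin_q x: real and imaginary part of the sum of the (ix)^n / [n]!. *)
Definition small_cos (q x : R) : R := even_series (cos_coef q) x.
Definition small_sin (q x : R) : R := x * even_series (sin_coef q) x.

(** Real part of e(qz) = (1 - (1 - q) z) e(z) at z = ix, where e(z) is the sum of the z^n / [n]!.
    Termwise this is q^n = 1 - (1 - q) [n]. *)
Lemma small_cos_qdiff q x : 0 < q < 1 -> 0 <= x <= / 2 ->
  small_cos q (q * x) = small_cos q x + (1 - q) * x * small_sin q x.
Proof.
  intros hq hx. unfold small_cos, small_sin, even_series.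
  assert (hqx : 0 <= q * x <= / 2) by nra.
  rewrite (Series_incr_1 (fun k => cos_coef q k * ((q * x) ^ 2) ^ k))
    by (apply even_series_ex; [intros; now apply coef_bound | easy]).
  rewrite (Series_incr_1 (fun k => cos_coef q k * (x ^ 2) ^ k))
    by (apply even_series_ex; [intros; now apply coef_bound | easy]).
  rewrite <- Rmult_assoc, <- Series_scal_l, Rplus_assoc, <- Series_plus.
  - f_equal. apply Series_ext. intros k. unfold cos_coef, sin_coef.
    replace (2 * S k)%nat with (S (2 * k + 1)) by lia. cbn [qfact].
    replace ((q * x) ^ 2) with (q ^ 2 * x ^ 2) by ring. rewrite Rpow_mult_distr, <- pow_mult.
    assert (h1 := qnum_ge_1 q (2 * k + 1) hq). assert (h2 := qfact_ge_1 q (2 * k + 1) hq).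
    assert (e : q ^ (2 * S k) = 1 - (1 - q) * qnum q (S (2 * k + 1))).
    { unfold qnum. replace (2 * S k)%nat with (S (2 * k + 1)) by lia. field. lra. }
    rewrite e. cbn [pow]. field. lra.
  - apply (ex_series_incr_1 (fun k => cos_coef q k * (x ^ 2) ^ k)).
    apply even_series_ex; [intros; now apply coef_bound | easy].
  - apply (ex_series_scal (V := R_NormedModule)).
    apply even_series_ex; [intros; now apply coef_bound | easy].
Qed.

Lemma small_sin_qdiff q x : 0 < q < 1 -> 0 <= x <= / 2 ->
  small_sin q (q * x) = small_sin q x - (1 - q) * x * small_cos q x.
Proof.
  intros hq hx. unfold small_cos, small_sin, even_series.
  rewrite (Rmult_comm q x), (Rmult_comm (1 - q) x), !Rmult_assoc, <- Rmult_minus_distr_l.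
  f_equal. rewrite <- !Series_scal_l, <- Series_minus.
  - apply Series_ext. intros k. unfold cos_coef, sin_coef.
    replace (2 * k + 1)%nat with (S (2 * k)) by lia. cbn [qfact].
    replace ((x * q) ^ 2) with (q ^ 2 * x ^ 2) by ring. rewrite Rpow_mult_distr, <- pow_mult.
    assert (h1 := qnum_ge_1 q (2 * k) hq). assert (h2 := qfact_ge_1 q (2 * k) hq).
    assert (e : q * q ^ (2 * k) = 1 - (1 - q) * qnum q (S (2 * k))).
    { unfold qnum. change (q ^ S (2 * k)) with (q * q ^ (2 * k)). field. lra. }
    transitivity ((-1) ^ k / (qfact q (2 * k) * qnum q (S (2 * k))) * (q * q ^ (2 * k)) * (x ^ 2) ^ k);
      [unfold Rdiv; ring|].
    rewrite e. field. lra.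
  - apply even_series_ex; [intros; now apply coef_bound | easy].
  - apply (ex_series_scal (V := R_NormedModule)).
    apply even_series_ex; [intros; now apply coef_bound | easy].
Qed.

(** The q-difference equation iterated: e(ix) times the product of the conjugate factors 1 - i c_j
    x, j <= n, is e(i q^(n+1) x). Both parts are carried along because the induction mixes them. *)
Lemma small_times_product q n x : 0 < q < 1 -> 0 <= x <= / 2 ->
  small_cos q x * cpol q n (x ^ 2) + small_sin q x * (x * spol q n (x ^ 2))
  = small_cos q (q ^ S n * x) /\
  small_sin q x * cpol q n (x ^ 2) - small_cos q x * (x * spol q n (x ^ 2))
  = small_sin q (q ^ S n * x).
Proof.
  intros hq hx. unfold cpol, spol. induction n as [|n [IH1 IH2]].
  - rewrite pow_1, small_cos_qdiff, small_sin_qdiff by easy.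
    cbn [cspol fst snd]. unfold cq. cbn [pow]. split; ring.
  - assert (hy : 0 <= q ^ S n * x <= / 2).
    { assert (h := pow_le_1 q (S n) hq). assert (0 < q ^ S n) by (apply pow_lt; lra). nra. }
    change (q ^ S (S n)) with (q * q ^ S n). rewrite Rmult_assoc.
    rewrite small_cos_qdiff, small_sin_qdiff, <- IH1, <- IH2 by easy.
    cbn [cspol fst snd]. unfold cq. split; ring.
Qed.

(** Real part of e(ix) E_q(-ix) = 1: in [small_times_product] the argument q^(n+1) x tends to 0,
    where cos_q equals 1. *)
Lemma small_big_identity q x : 0 < q < 1 -> 0 <= x <= / 2 ->
  small_cos q x * (rho q x * cos (theta q x)) + small_sin q x * (rho q x * sin (theta q x)) = 1.
Proof.
  intros hq hx.
  assert (hr := rho_n_lim q x hq). assert (ht := theta_n_lim q x hq).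
  assert (h1 : is_lim_seq
    (fun n => small_cos q x * (rho_n q n x * cos (theta_n q n x))
              + small_sin q x * (rho_n q n x * sin (theta_n q n x)))
    (small_cos q x * (rho q x * cos (theta q x)) + small_sin q x * (rho q x * sin (theta q x)))).
  { apply is_lim_seq_plus'; (apply is_lim_seq_mult'; [apply is_lim_seq_const|]);
      apply is_lim_seq_mult'; try easy; [now apply is_lim_seq_cos | now apply is_lim_seq_sin]. }
  assert (h2 : is_lim_seq (fun n => small_cos q (q ^ S n * x)) 1).
  { assert (hq0 : is_lim_seq (fun n => 2 * q ^ S n) 0).
    { replace (Finite 0) with (Rbar_mult 2 0) by (simpl; f_equal; ring).
      apply is_lim_seq_scal_l. apply -> (is_lim_seq_incr_1 (fun n => q ^ n)).
      apply is_lim_seq_geom. rewrite Rabs_pos_eq; lra. }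
    apply is_lim_seq_ext with (fun n => 1 + (small_cos q (q ^ S n * x) - 1)); [intros; ring|].
    replace (Finite 1) with (Finite (1 + 0)) by (f_equal; ring). apply is_lim_seq_plus'; [apply is_lim_seq_const|].
    apply (proj2 (is_lim_seq_abs_0 _)).
    apply is_lim_seq_le_le with (fun _ => 0) (fun n => 2 * q ^ S n);
      [|apply is_lim_seq_const | easy].
    intros n. split; [apply Rabs_pos|].
    assert (h := pow_le_1 q (S n) hq). assert (h' : 0 < q ^ S n) by (apply pow_lt; lra).
    set (p := q ^ S n) in *.
    assert (hy : 0 <= p * x <= / 2) by nra.
    unfold small_cos. rewrite even_series_shift by (try easy; intros; now apply coef_bound).
    replace (cos_coef q 0) with 1 by (unfold cos_coef; simpl; field).
    replace (1 + (p * x) ^ 2 * even_series (fun k => cos_coef q (S k)) (p * x) - 1)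
      with ((p * x) ^ 2 * even_series (fun k => cos_coef q (S k)) (p * x)) by ring.
    rewrite Rabs_mult, (Rabs_pos_eq (_ ^ 2)) by nra.
    assert (hb := even_series_bound (fun k => cos_coef q (S k)) (p * x)
                    (fun k => coef_bound q (S k) _ hq) hy).
    assert (hb' := Rabs_pos (even_series (fun k => cos_coef q (S k)) (p * x))).
    rewrite Rmult_comm. apply Rmult_le_compat; try easy; nra. }
  apply is_lim_seq_unique in h1. apply is_lim_seq_ext with
    (v := fun n => small_cos q x * (rho_n q n x * cos (theta_n q n x))
              + small_sin q x * (rho_n q n x * sin (theta_n q n x))) in h2.
  - apply is_lim_seq_unique in h2. rewrite h1 in h2. now injection h2.
  - intros n. rewrite polar_cpol, polar_spol. symmetry. now apply small_times_product.
Qed.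

(** The pole factor is normalised to 1 at x = 0. Then xi^2 / (xi^2 - x^2) = 1 + (x^2 / xi^2) xi^2 /
    (xi^2 - x^2), so splitting off a coefficient merely replaces w_k by w_k / xi_k^2. *)
Definition pole_series (w xi : nat -> R) (x : R) : R :=
  Series (fun k => w k * ((xi k) ^ 2 / ((xi k) ^ 2 - x ^ 2))).

Lemma pole_series_asym n (w xi : nat -> R) B q : 0 < q < 1 ->
  (forall k, 1 <= xi k) -> (forall k, Rabs (w k) <= B * q ^ k) ->
  asym n (pole_series w xi) (fun m => Series (fun k => w k / (xi k) ^ (2 * m))).
Proof.
  intros hq hxi. revert w.
  assert (hfac : forall x k, 0 < x < / 2 -> Rabs ((xi k) ^ 2 / ((xi k) ^ 2 - x ^ 2)) <= 2).
  { intros x k hx. specialize (hxi k). assert (h1 : 1 <= xi k ^ 2) by nra.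
    assert (h2 : x ^ 2 <= / 4) by nra. assert (h3 : 0 <= x ^ 2) by nra.
    rewrite Rabs_pos_eq; [apply Rle_div_l; lra | apply Rdiv_le_0_compat; lra]. }
  assert (hterm : forall w x k, (forall k, Rabs (w k) <= B * q ^ k) -> 0 < x < / 2 ->
    Rabs (w k * ((xi k) ^ 2 / ((xi k) ^ 2 - x ^ 2))) <= (2 * B) * q ^ k).
  { intros w x k hw hx. rewrite Rabs_mult. specialize (hfac x k hx). specialize (hw k).
    replace (2 * B * q ^ k) with ((B * q ^ k) * 2) by ring.
    apply Rmult_le_compat; try apply Rabs_pos; easy. }
  induction n as [|n IH]; intros w hw.
  - exists (2 * B / (1 - q)). intros x hx. apply Rabs_Series_geometric_bound; [easy|].
    intros k. now apply hterm.
  - assert (hw' : forall k, Rabs (w k / xi k ^ 2) <= B * q ^ k).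
    { intros k. eapply Rle_trans; [|apply hw]. unfold Rdiv.
      rewrite Rabs_mult, Rabs_inv. specialize (hxi k).
      rewrite <- (Rmult_1_r (Rabs (w k))) at 2. apply Rmult_le_compat_l; [apply Rabs_pos|].
      rewrite <- Rinv_1. apply Rinv_le_contravar; [lra|]. rewrite Rabs_pos_eq; nra. }
    exists (pole_series (fun k => w k / (xi k) ^ 2) xi). split.
    + eapply asym_ext; [reflexivity| |apply (IH _ hw')].
      intros m. apply Series_ext. intros k. specialize (hxi k).
      replace (2 * S m)%nat with (2 + 2 * m)%nat by lia. rewrite pow_add. field.
      split; [apply pow_nonzero|]; lra.
    + intros x hx. unfold pole_series. rewrite <- Series_scal_l, <- Series_plus.
      * apply Series_ext. intros k. specialize (hxi k). rewrite Nat.mul_0_r. simpl pow at 3.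
        assert (1 <= xi k ^ 2) by nra. assert (x ^ 2 <= / 4) by nra.
        cbn [pow]. field. nra.
      * apply ex_series_geometric_bound with B q; [easy|]. intros k.
        rewrite Nat.mul_0_r. cbn [pow]. unfold Rdiv. rewrite Rinv_1, Rmult_1_r. apply hw.
      * apply (ex_series_scal (V := R_NormedModule)).
        apply ex_series_geometric_bound with (2 * B) q; [easy|]. intros k. now apply (hterm (fun k => w k / xi k ^ 2)).
Qed.

(** Up to sign a pole series with weights a_k / (theta'(xi_k) xi_k^2), which are O(q^k) by
    [weight_bound]. *)
Lemma residue_series_asym n q (t xi a : nat -> R) A0 : 0 < q < 1 ->
  (forall k, (INR k + / 2) * PI <= t k) ->
  (forall k, 0 < xi k /\ theta q (xi k) = t k) -> (forall k, Rabs (a k) <= A0) ->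
  asym n (fun x => Series (fun k => a k / gser datf q (xi k) / (x ^ 2 - (xi k) ^ 2)))
    (fun m => - Series (fun k => a k / gser datf q (xi k) / (xi k) ^ (2 * S m))).
Proof.
  intros hq ht hxi ha.
  assert (hlow : forall k, 1 <= q ^ k * xi k).
  { intros k. destruct (hxi k). apply (root_lower_limit q k _ (t k)); try easy. lra. }
  assert (hxi1 : forall k, 1 <= xi k).
  { intros k. specialize (hlow k). assert (h := pow_le_1 q k hq). destruct (hxi k). nra. }
  assert (hw : forall k, Rabs (a k / gser datf q (xi k) / xi k ^ 2) <= (A0 * wbound q) * q ^ k).
  { intros k. assert (hd := dtheta_ge q k (xi k) hq). assert (hp := dtheta_pos q (xi k) hq).
    assert (h := weight_bound q k (xi k) _ hq (hlow k) hd). specialize (hxi1 k).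
    assert (hx2 : 0 < xi k ^ 2) by nra.
    unfold Rdiv. rewrite !Rabs_mult, !Rabs_inv, !(Rabs_pos_eq (gser _ _ _)), (Rabs_pos_eq (xi k ^ 2)) by lra.
    apply (Rle_div_l _ _ (xi k ^ 2)); [easy|].
    replace (A0 * wbound q * q ^ k * xi k ^ 2) with (A0 * (wbound q * q ^ k * xi k ^ 2)) by ring.
    apply Rmult_le_compat; [apply Rabs_pos | left; now apply Rinv_0_lt_compat | apply ha | easy]. }
  assert (H := pole_series_asym n _ xi _ q hq hxi1 hw).
  (* Negation, expressed as a linear combination. *)
  assert (H' := asym_lincomb n (-1) 0 _ _ _ _ H H).
  eapply asym_ext; [| |exact H'].
  - intros x hx. cbn beta. rewrite Rmult_0_l, Rplus_0_r. unfold pole_series.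
    rewrite <- Series_scal_l. apply Series_ext. intros k. specialize (hxi1 k).
    assert (hp := dtheta_pos q (xi k) hq).
    assert (1 <= xi k ^ 2) by nra. assert (x ^ 2 <= / 4) by nra.
    field. repeat split; try lra; nra.
  - intros m. cbn beta. rewrite Rmult_0_l, Rplus_0_r, <- Series_opp, <- Series_scal_l.
    apply Series_ext. intros k. specialize (hxi1 k).
    assert (hp := dtheta_pos q (xi k) hq).
    replace (2 * S m)%nat with (2 + 2 * m)%nat by lia. rewrite pow_add. field.
    split; [lra|]. split; [apply pow_nonzero|]; lra.
Qed.

(** * The values of the Dirichlet-type series *)

(** Strong induction on k: once the earlier zeros carry the earlier phases, x_k has at least
    [phase k], and it cannot have more, since the intermediate value theorem would give a zero
    missing from the enumeration. *)
Lemma zeros_phases q (F : C -> C) (x phase : nat -> R) : 0 < q < 1 ->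
  (forall i j, (i < j)%nat -> phase i < phase j) -> 0 < phase O ->
  (forall t, 0 < t -> (F (RtoC t) = RtoC 0 <-> exists j, theta q t = phase j)) ->
  positive_zeros F x -> forall k, 0 < x k /\ theta q (x k) = phase k.
Proof.
  intros hq hph hph0 hF [hinc hz].
  assert (hmono : forall i j, (i <= j)%nat -> x i <= x j).
  { intros i j h. induction h as [|j h IH]; [lra|]. specialize (hinc j). lra. }
  assert (hle : forall i j, (i <= j)%nat -> phase i <= phase j).
  { intros i j h. destruct (Nat.eq_dec i j) as [->|]; [lra|]. left; apply hph; lia. }
  assert (hx : forall k, 0 < x k /\ exists j, theta q (x k) = phase j).
  { intros k. destruct (proj2 (hz (x k)) (ex_intro _ k eq_refl)) as [h1 h2].
    split; [easy | now apply hF]. }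
  assert (hstep : forall k, (forall i, (i < k)%nat -> theta q (x i) < phase k) ->
            phase k <= theta q (x k) -> theta q (x k) = phase k).
  { intros k hlow hk. destruct (hx k) as [hpos _].
    assert (hpk := hle O k ltac:(lia)).
    destruct (theta_root_le q (phase k) (x k) hq hpos ltac:(lra)) as (y & hy & e).
    assert (hyz : F (RtoC y) = RtoC 0) by (apply hF; [lra | now exists k]).
    destruct (proj1 (hz y) (conj (proj1 hy) hyz)) as [i hi].
    destruct (Compare_dec.le_lt_dec k i) as [h|h].
    - assert (h' := hmono k i h). replace (x k) with y by lra. easy.
    - specialize (hlow i h). rewrite hi in hlow. lra. }
  intros k. split; [apply hx|].
  induction k as [k IH] using (well_founded_induction Wf_nat.lt_wf).
  apply hstep.
  - intros i hi. rewrite (IH i hi). now apply hph.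
  (* If x_k had a phase of index j < k, then x_j < x_k would share a phase, against the monotonicity
     of theta. *)
  - destruct (hx k) as [_ [j hj]]. rewrite hj. apply hle.
    destruct (Compare_dec.le_lt_dec k j) as [h|h]; [easy|].
    assert (e := IH j h). rewrite <- hj in e. exfalso.
    assert (h' : x j < x k).
    { assert (h2 := hmono (S j) k ltac:(lia)). specialize (hinc j). lra. }
    apply (theta_increasing q) in h'; [lra|easy].
Qed.

(** As a <= 1, a negative z would make u nonpositive. The lemma serves a = 1 for sine and a = 1/2
    for cosine. *)
Lemma phase_of_multiple (z : Z) (a u : R) : 0 < a <= 1 -> 0 < u -> u = (IZR z + a) * PI ->
  exists j, u = (INR j + a) * PI.
Proof.
  intros ha hu e. assert (hP := PI_RGT_0).
  assert (hz : (0 <= z)%Z).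
  { destruct (Z_lt_le_dec z 0) as [h|h]; [|easy]. exfalso.
    assert (h' : (z <= -1)%Z) by lia. apply IZR_le in h'. nra. }
  exists (Z.to_nat z). rewrite INR_IZR_INZ, Z2Nat.id by easy. exact e.
Qed.

Lemma rho_mult_eq_0 q t v : RtoC (rho q t * v) = RtoC 0 <-> v = 0.
Proof.
  assert (h := rho_pos q t). split.
  - intros e. apply RtoC_inj in e. apply Rmult_integral in e. lra.
  - intros ->. now rewrite Rmult_0_r.
Qed.

Lemma theta_pos q t : 0 < q < 1 -> 0 < t -> 0 < theta q t.
Proof. intros hq ht. rewrite <- (theta_0 q). now apply theta_increasing. Qed.

Lemma Sin_q_zeros_phases q xi : 0 < q < 1 -> positive_zeros (Sin_q q) xi ->
  forall k, 0 < xi k /\ theta q (xi k) = sin_phase k.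
Proof.
  intros hq. assert (hP := PI_RGT_0). apply zeros_phases; [easy| | |].
  - intros i j h. apply lt_INR in h. unfold sin_phase. nra.
  - unfold sin_phase. simpl. lra.
  - intros t ht. rewrite Sin_q_real, rho_mult_eq_0 by easy. split.
    + intros h. destruct (sin_eq_0_0 _ h) as [z hz].
      apply (phase_of_multiple (z - 1)); [lra | now apply theta_pos |].
      rewrite minus_IZR, hz. ring.
    + intros [j ->]. apply sin_phase_values.
Qed.

Lemma Cos_q_zeros_phases q eta : 0 < q < 1 -> positive_zeros (Cos_q q) eta ->
  forall k, 0 < eta k /\ theta q (eta k) = cos_phase k.
Proof.
  intros hq. assert (hP := PI_RGT_0). apply zeros_phases; [easy| | |].
  - intros i j h. apply lt_INR in h. unfold cos_phase. nra.
  - unfold cos_phase. simpl. lra.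
  - intros t ht. rewrite Cos_q_real, rho_mult_eq_0 by easy. split.
    + intros h. destruct (cos_eq_0_0 _ h) as [z hz].
      apply (phase_of_multiple z); [lra | now apply theta_pos |].
      rewrite hz. field.
    + intros [j ->]. apply cos_phase_values.
Qed.

(** Coefficient of x^(2m) in x Cot_q x. The constant 1 is the term split off at 0 and has no series
    expression. *)
Definition cot_coef (q : R) (xi : nat -> R) (m : nat) : R :=
  match m with
  | O => 1
  | S _ => - Series (fun k => 2 / gser datf q (xi k) / (xi k) ^ (2 * m))
  end.

Definition csc_coef (q : R) (xi : nat -> R) (m : nat) : R :=
  match m with
  | O => 1
  | S _ => - Series (fun k => 2 / (rho q (xi k) * (-1) ^ S k) / gser datf q (xi k)
                              / (xi k) ^ (2 * m))
  end.

Definition tan_coef (q : R) (eta : nat -> R) (m : nat) : R :=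
  - Series (fun k => -2 / gser datf q (eta k) / (eta k) ^ (2 * S m)).

Definition sec_coef (q : R) (eta : nat -> R) (m : nat) : R :=
  - Series (fun k => - (2 * eta k) / (rho q (eta k) * (-1) ^ k) / gser datf q (eta k)
                     / (eta k) ^ (2 * S m)).

Lemma cot_csc_function_identity q x : 0 < q < 1 -> 0 < x < / 2 ->
  x / (rho q x * sin (theta q x))
  = small_cos q x * (x * cos (theta q x) / sin (theta q x))
    + x ^ 2 * even_series (sin_coef q) x.
Proof.
  intros hq hx. assert (e := small_big_identity q x hq ltac:(lra)).
  assert (h := rho_pos q x).
  assert (hs : 0 < sin (theta q x)) by (apply sin_gt_0; assert (h' := theta_small q x hq hx); lra).
  unfold small_sin in e.
  rewrite <- (Rmult_1_r x) at 1. rewrite <- e. field. lra.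
Qed.

Lemma tan_sec_function_identity q x : 0 < q < 1 -> 0 < x < / 2 ->
  1 / (rho q x * cos (theta q x))
  = small_cos q x
    + x ^ 2 * (even_series (sin_coef q) x * (sin (theta q x) / (x * cos (theta q x)))).
Proof.
  intros hq hx. assert (e := small_big_identity q x hq ltac:(lra)).
  assert (h := rho_pos q x).
  assert (hs : 0 < cos (theta q x)) by (apply cos_gt_0; assert (h' := theta_small q x hq hx); lra).
  unfold small_sin in e.
  rewrite <- e. field. lra.
Qed.

Lemma asym_shift n g a : asym n g a ->
  asym (S n) (fun x => x ^ 2 * g x) (fun m => match m with O => 0 | S j => a j end).
Proof. intros h. exists g. split; [easy | intros; ring]. Qed.

(** Coefficient of x^(2n+2) in x / Sin_q = cos_q (x Cot_q) + x sin_q; the last summand contributes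
    [sin_coef q n] because x sin_q starts with x^2. *)
Lemma csc_coef_identity q xi n : 0 < q < 1 ->
  (forall k, 0 < xi k /\ theta q (xi k) = sin_phase k) ->
  csc_coef q xi (S n) = conv (cos_coef q) (cot_coef q xi) (S n) + sin_coef q n.
Proof.
  intros hq hxi.
  assert (ht : forall k, (INR k + / 2) * PI <= sin_phase k).
  { intros k. unfold sin_phase. assert (hP := PI_RGT_0). apply Rmult_le_compat_r; lra. }
  assert (hcot : asym (S (S n)) (fun x => x * cos (theta q x) / sin (theta q x)) (cot_coef q xi)).
  { eexists. split; [|intros x hx; now apply cot_expansion].
    apply (residue_series_asym _ q sin_phase xi (fun _ => 2) 2 hq ht hxi).
    intros; rewrite Rabs_pos_eq; lra. }
  assert (hcsc : asym (S (S n)) (fun x => x / (rho q x * sin (theta q x))) (csc_coef q xi)).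
  { eexists. split; [|intros x hx; now apply csc_expansion].
    apply (residue_series_asym _ q sin_phase xi
             (fun k => 2 / (rho q (xi k) * (-1) ^ S k)) 2 hq ht hxi).
    intros k. destruct (rho_ge q (xi k) hq) as [h _].
    unfold Rdiv. rewrite Rabs_mult, Rabs_inv, Rabs_mult, pow_1_abs, Rmult_1_r.
    rewrite !Rabs_pos_eq by lra. apply Rle_div_l; lra. }
  assert (hcos : asym (S (S n)) (small_cos q) (cos_coef q))
    by (apply even_series_asym; intros; now apply coef_bound).
  assert (hsin := asym_shift (S n) _ _
    (even_series_asym (S n) (sin_coef q) (fun k => coef_bound q k _ hq))).
  assert (hrhs := asym_lincomb _ 1 1 _ _ _ _ (asym_mult _ _ _ _ _ hcos hcot) hsin).
  apply asym_ext with (g := fun x => x / (rho q x * sin (theta q x)))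
    (b := fun m => 1 * conv (cos_coef q) (cot_coef q xi) m
                   + 1 * match m with O => 0 | S j => sin_coef q j end) in hrhs; [|..].
  - rewrite (asym_unique _ _ _ _ hcsc hrhs). ring.
  - intros x hx. rewrite cot_csc_function_identity by easy. ring.
  - easy.
Qed.

(** Coefficient of x^(2n+2) in 1 / Cos_q = cos_q + x^2 (sin_q / x) (Tan_q / x). The factor x^2
    lowers the index of the convolution to n. *)
Lemma sec_coef_identity q eta n : 0 < q < 1 ->
  (forall k, 0 < eta k /\ theta q (eta k) = cos_phase k) ->
  sec_coef q eta (S n) = cos_coef q (S n) + conv (sin_coef q) (tan_coef q eta) n.
Proof.
  intros hq heta.
  assert (ht : forall k, (INR k + / 2) * PI <= cos_phase k) by (intros; unfold cos_phase; lra).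
  assert (htan : asym (S n) (fun x => sin (theta q x) / (x * cos (theta q x))) (tan_coef q eta)).
  { eapply asym_ext; [| |apply (residue_series_asym _ q cos_phase eta (fun _ => -2) 2 hq ht heta)].
    - intros x hx. symmetry. now apply tan_expansion.
    - easy.
    - intros; rewrite Rabs_left; lra. }
  assert (hsec : asym (S (S n)) (fun x => 1 / (rho q x * cos (theta q x))) (sec_coef q eta)).
  { eapply asym_ext; [| |apply (residue_series_asym _ q cos_phase eta
             (fun k => - (2 * eta k) / (rho q (eta k) * (-1) ^ k)) (2 / cq q 0) hq ht heta)].
    - intros x hx. symmetry. now apply sec_expansion.
    - easy.
    - intros k. destruct (heta k) as [h0 _]. destruct (rho_ge q (eta k) hq) as [h h1].
      assert (hc := cq_pos q 0 hq). rewrite Rabs_pos_eq in h1 by lra.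
      unfold Rdiv. rewrite Rabs_mult, Rabs_inv, Rabs_Ropp, (Rabs_mult (rho _ _)), pow_1_abs, Rmult_1_r.
      rewrite !Rabs_pos_eq by lra. apply Rle_div_l; [lra|].
      apply Rle_trans with (2 * / cq q 0 * (cq q 0 * eta k)); [right; field; lra|].
      apply Rmult_le_compat_l; [|easy].
      assert (h2 : 0 < / cq q 0) by now apply Rinv_0_lt_compat. lra. }
  assert (hcos : asym (S (S n)) (small_cos q) (cos_coef q))
    by (apply even_series_asym; intros; now apply coef_bound).
  assert (hsin := asym_shift (S n) _ _ (asym_mult _ _ _ _ _
    (even_series_asym (S n) (sin_coef q) (fun k => coef_bound q k _ hq)) htan)).
  assert (hrhs := asym_lincomb _ 1 1 _ _ _ _ hcos hsin).
  apply asym_ext with (g := fun x => 1 / (rho q x * cos (theta q x)))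
    (b := fun m => 1 * cos_coef q m
       + 1 * match m with O => 0 | S j => conv (sin_coef q) (tan_coef q eta) j end) in hrhs; [|..].
  - rewrite (asym_unique _ _ _ _ hsec hrhs). ring.
  - intros x hx. rewrite tan_sec_function_identity by easy. ring.
  - easy.
Qed.

Ltac neq0 :=
  solve [easy | lra | apply Ropp_neq_0_compat; neq0
        | apply Rmult_integral_contrapositive_currified; neq0].

Lemma Rcpow_INR (x : R) (n : nat) : 0 < x -> Rcpow x (RtoC (INR n)) = RtoC (x ^ n).
Proof.
  intros hx. unfold Rcpow. simpl Re. simpl Im.
  rewrite Rmult_0_l, cos_0, sin_0, <- Rpower_pow by easy. unfold Rpower.
  apply injective_projections; simpl; ring.
Qed.

Lemma CSeries_RtoC (f : nat -> C) (a : nat -> R) :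
  (forall k, f k = RtoC (a k)) -> CSeries f = RtoC (Series a).
Proof.
  intros H. unfold CSeries. apply injective_projections; cbn [fst snd RtoC].
  - apply Series_ext. intros k. now rewrite H.
  (* As a multiple of a series, the zero series is evaluated by [Series_scal_l] without a
     convergence argument. *)
  - rewrite (Series_ext _ (fun _ => 0 * 0)).
    + rewrite Series_scal_l. ring.
    + intros k. rewrite H. simpl. ring.
Qed.

Lemma sum_n_RtoC (f : nat -> C) (a : nat -> R) n :
  (forall k, (k <= n)%nat -> f k = RtoC (a k)) -> sum_n f n = RtoC (sum_n a n).
Proof.
  intros H. induction n as [|n IH].
  - rewrite !sum_O. apply H; lia.
  - rewrite !sum_Sn, IH, (H (S n)) by (try lia; intros; apply H; lia).
    unfold plus; simpl. now rewrite RtoC_plus.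
Qed.

(** At a zero of Sin_q the quotient Cos_q / Sin_q' is 1 / theta'. For m = 0 the convention -1/2
    matches the constant term 1. *)
Lemma zeta_q_value q xi m : 0 < q < 1 ->
  (forall k, 0 < xi k /\ theta q (xi k) = sin_phase k) ->
  zeta_q_conv q xi (INR (2 * m)) = RtoC (- (1 / 2) * cot_coef q xi m).
Proof.
  intros hq hxi. unfold zeta_q_conv.
  destruct m as [|m].
  - rewrite Nat.mul_0_r. simpl INR. destruct (Ceq_dec (RtoC 0) (RtoC 0)) as [_|h]; [|easy].
    simpl cot_coef. now rewrite Rmult_1_r.
  - destruct (Ceq_dec (RtoC (INR (2 * S m))) (RtoC 0)) as [h|_].
    { apply RtoC_inj in h. apply (INR_eq _ 0) in h. lia. }
    unfold zeta_q, cot_coef.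
    rewrite (CSeries_RtoC _ (fun k => / 2 * (2 / gser datf q (xi k) / (xi k) ^ (2 * S m)))).
    + rewrite Series_scal_l. f_equal. field.
    + intros k. destruct (hxi k) as [h1 h2]. destruct (sin_phase_values k) as [h3 h4].
      rewrite <- h2 in h3, h4.
      rewrite Cos_q_real, C_derive_Sin_q, Rcpow_INR, h4 by easy.
      assert (hr := rho_pos q (xi k)). assert (hd := dtheta_pos q (xi k) hq).
      assert (hs := pow_m1_neq_0 (S k)). assert (hp := pow_lt (xi k) (2 * S m) h1).
      rewrite <- !RtoC_div, <- RtoC_mult by neq0. f_equal. field. repeat split; neq0.
Qed.

Lemma eta_q_value q xi m : 0 < q < 1 ->
  (forall k, 0 < xi k /\ theta q (xi k) = sin_phase k) ->
  eta_q q xi (INR (2 * S m)) = RtoC (1 / 2 * csc_coef q xi (S m)).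
Proof.
  intros hq hxi. unfold eta_q, csc_coef.
  rewrite (CSeries_RtoC _ (fun k => / 2 * (2 / (rho q (xi k) * (-1) ^ S k) / gser datf q (xi k)
                              / (xi k) ^ (2 * S m)))).
  - rewrite Series_scal_l, <- RtoC_opp. f_equal. field.
  - intros k. destruct (hxi k) as [h1 h2]. destruct (sin_phase_values k) as [h3 h4].
    rewrite <- h2 in h3, h4.
    rewrite C_derive_Sin_q, Rcpow_INR, h4 by easy.
    assert (hr := rho_pos q (xi k)). assert (hd := dtheta_pos q (xi k) hq).
    assert (hs := pow_m1_neq_0 (S k)). assert (hp := pow_lt (xi k) (2 * S m) h1).
    rewrite <- !RtoC_div, <- RtoC_mult by neq0. f_equal. field. repeat split; neq0.
Qed.

Lemma zeta_q_star_value q eta m : 0 < q < 1 ->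
  (forall k, 0 < eta k /\ theta q (eta k) = cos_phase k) ->
  zeta_q_star q eta (INR (2 * S m)) = RtoC (1 / 2 * tan_coef q eta m).
Proof.
  intros hq heta. unfold zeta_q_star, tan_coef.
  rewrite (CSeries_RtoC _ (fun k => / 2 * (-2 / gser datf q (eta k) / (eta k) ^ (2 * S m)))).
  - rewrite Series_scal_l, <- RtoC_opp. f_equal. field.
  - intros k. destruct (heta k) as [h1 h2]. destruct (cos_phase_values k) as [h3 h4].
    rewrite <- h2 in h3, h4.
    rewrite Sin_q_real, C_derive_Cos_q, Rcpow_INR, h4 by easy.
    assert (hr := rho_pos q (eta k)). assert (hd := dtheta_pos q (eta k) hq).
    assert (hs := pow_m1_neq_0 k). assert (hp := pow_lt (eta k) (2 * S m) h1).
    rewrite <- !RtoC_div, <- RtoC_mult by neq0. f_equal. field. repeat split; neq0.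
Qed.

Lemma eta_q_star_value q eta m : 0 < q < 1 ->
  (forall k, 0 < eta k /\ theta q (eta k) = cos_phase k) ->
  eta_q_star q eta (INR (2 * m + 1)) = RtoC (1 / 2 * sec_coef q eta m).
Proof.
  intros hq heta. unfold eta_q_star, sec_coef.
  rewrite (CSeries_RtoC _ (fun k => / 2 * (- (2 * eta k) / (rho q (eta k) * (-1) ^ k)
                              / gser datf q (eta k) / (eta k) ^ (2 * S m)))).
  - rewrite Series_scal_l, <- RtoC_opp. f_equal. field.
  - intros k. destruct (heta k) as [h1 h2]. destruct (cos_phase_values k) as [h3 h4].
    rewrite <- h2 in h3, h4.
    rewrite C_derive_Cos_q, Rcpow_INR, h4 by easy.
    assert (hr := rho_pos q (eta k)). assert (hd := dtheta_pos q (eta k) hq).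
    assert (hs := pow_m1_neq_0 k). assert (hp := pow_lt (eta k) (2 * m + 1) h1).
    (* The factor eta_k in the residue of 1 / Cos_q cancels one of the 2m + 2 powers, which is why
       odd arguments appear. *)
    replace (2 * S m)%nat with (S (2 * m + 1)) by lia.
    change (eta k ^ S (2 * m + 1)) with (eta k * eta k ^ (2 * m + 1)).
    rewrite <- !RtoC_div, <- RtoC_mult by neq0. f_equal. field. repeat split; neq0.
Qed.

Theorem theorem6p4 (q : R) (hq : 0 < q < 1) (xi eta : nat -> R)
    (hxi : positive_zeros (Sin_q q) xi) (heta : positive_zeros (Cos_q q) eta)
    (n : nat) (hn : (1 <= n)%nat) :
  eta_q q xi (INR (2 * n)) =
    (RtoC ((-1) ^ (n + 1) / (2 * qfact q (2 * n - 1)))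
     + sum_n (fun k : nat =>
                RtoC ((-1) ^ (k + 1) / qfact q (2 * k))
                * zeta_q_conv q xi (INR (2 * n - 2 * k)))%C n)%C
  /\
  eta_q_star q eta (INR (2 * n + 1)) =
    (RtoC ((-1) ^ n / (2 * qfact q (2 * n)))
     + sum_n (fun k : nat =>
                RtoC ((-1) ^ k / qfact q (2 * k + 1))
                * zeta_q_star q eta (INR (2 * n - 2 * k)))%C (n - 1))%C.
Proof.
  assert (hX := Sin_q_zeros_phases q xi hq hxi).
  assert (hE := Cos_q_zeros_phases q eta hq heta).
  destruct n as [|p]; [lia|]. split.
  - rewrite eta_q_value, csc_coef_identity by easy.
    rewrite (sum_n_RtoC _ (fun k => cos_coef q k * cot_coef q xi (S p - k)%nat * (1 / 2))).
    + rewrite <- RtoC_plus. f_equal. rewrite sum_n_Rmult_r. unfold conv, sin_coef.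
      replace (2 * S p - 1)%nat with (2 * p + 1)%nat by lia.
      replace (S p + 1)%nat with (p + 2)%nat by lia. rewrite pow_add.
      assert (h := qfact_ge_1 q (2 * p + 1) hq). field. lra.
    (* The subtraction of naturals is exact for k <= n; the last index k = n reaches the
       conventional value at 0. *)
    + intros k hk. replace (2 * S p - 2 * k)%nat with (2 * (S p - k))%nat by lia.
      rewrite zeta_q_value, <- RtoC_mult by easy. f_equal. unfold cos_coef.
      rewrite pow_add. assert (h := qfact_ge_1 q (2 * k) hq). field. lra.
  - rewrite eta_q_star_value, sec_coef_identity by easy.
    replace (S p - 1)%nat with p by lia.
    rewrite (sum_n_RtoC _ (fun k => sin_coef q k * tan_coef q eta (p - k)%nat * (1 / 2))).
    + rewrite <- RtoC_plus. f_equal. rewrite sum_n_Rmult_r. unfold conv, cos_coef.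
      assert (h := qfact_ge_1 q (2 * S p) hq). field. lra.
    + intros k hk. replace (2 * S p - 2 * k)%nat with (2 * S (p - k))%nat by lia.
      rewrite zeta_q_star_value, <- RtoC_mult by easy. f_equal. unfold sin_coef. ring.
Qed.
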